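(* In the setting of the context, suppose there is a constant $\underline a>0$ such that $-\xi^\top A(x)\xi\ge\underline a|\xi|^2$ and $c(x)\ge0$ for all $x\in\Omega$ and $\xi\in\mathbb{R}^d$. Let $S>0$, let $M>0$ be sufficiently large in terms of $d$ and $S$, and assume $2N-1\ge3M\ln(15M)$. Let $\sigma_1\ge\dots\ge\sigma_{2N}$ be the singular values of $\mathbf\Psi$, with the convention $\sigma_1/\sigma_{2N}=\infty$ when $\sigma_{2N}=0$. Let $a_{\mathrm F}=3\cdot2^{1-1/d}/(112e)$, and let $a_{\mathrm T}=a_{\mathrm T}(d,S)>0$ be the constant described in the context. (1) Fourier features. Let $k_j\in[-S,S]^d$. Define $C,G\ge0$ by $C^2=n_1^{-1}\sum_{i=1}^{n_1}c^2(x_i)$ and $G^2=n_2^{-1}\sum_{i=n_1+1}^{n}g_2^2(x_i)$. Then $$\frac{\sigma_1}{\sigma_{2N}}\gtrsim_{\Omega,d,\{\Lambda_i\}_{i=1}^5,S}\frac{\sqrt{n_1}(\underline a+C)+\sqrt{n_2}\,G}{\sqrt{nN}}\exp(a_{\mathrm F}M^{1/d}\ln M).$$ (2) Tanh features. Let $k_j\in[-S,S]^d$ and $|v_j|\le dS$. Assume $b\equiv0$ and that, for some $r_0>0$ independent of $M$ and $N$, the interior collocation points satisfy $$\inf_{\theta\in\mathbb{S}^{d-1}}\Bigl(\max_{1\le i\le n_1}\theta^\top x_i-\min_{1\le i\le n_1}\theta^\top x_i\Bigr)\ge2r_0.$$ Then, with $\widetilde a_{\mathrm T}=\min\{a_{\mathrm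 T},d\ln2/(4e)\}$, $$\frac{\sigma_1}{\sigma_{2N}}\gtrsim_{\Omega,d,\{\Lambda_i\}_{i=1}^5,S,r_0}\frac{\underline a}{\sqrt{nN}}\exp(\widetilde a_{\mathrm T}M^{1/d}).$$
   Context: $x\gtrsim_{\bullet}y$ means $x\ge cy$ with $c>0$ depending only on the subscripts ($\lesssim$ similarly). $\Omega\subset(-1,1)^d$ is a bounded Lipschitz domain with unit outward normal $\mathbf n$. The operators are $Lu=\sum_{k,l}a_{kl}\partial_{kl}u+\sum_kb_k\partial_ku+cu$ in $\Omega$ and $Bu=g_1\frac{\partial u}{\partial\mathbf n}+g_2u$ on $\partial\Omega$, where $A=(a_{kl})$ is symmetric, $b=(b_1,\dots,b_d)^\top$, and $\|A(x)\|_2\le\Lambda_1$, $|b(x)|\le\Lambda_2$, $|c(x)|\le\Lambda_3$ in $\Omega$, $|g_1|\le\Lambda_4$, $|g_2|\le\Lambda_5$ on $\partial\Omega$, for positive constants $\Lambda_i$ (the bounds holding at the collocation points below). Put $\widetilde L=L$ in $\Omega$ and $\widetilde L=B$ on $\partial\Omega$. Collocation points: $x_1,\dots,x_{n_1}\in\Omega$ and $x_{n_1+1},\dots,x_{n_1+n_2}\in\partial\Omega$ (points where $\mathbf n$ is defined), $n_1,n_2\in\mathbb{N}_+$, $n=n_1+n_2>2N$. The random feature matrix is $\mathbf\Psi=(\Psi_{ij})\in\mathbb{R}^{n\times2N}$, $\Psi_{ij}=\widetilde L\psi_j(x_i)$. Fourier features: $\psi_j(x)=\cos(k_j^\top x)$,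 $\psi_{j+N}(x)=\sin(k_j^\top x)$ for $1\le j\le N$. $\tanh$ features: $\psi_j(x)=\tanh(k_j^\top x+v_j)$ for $1\le j\le2N$. The constant $a_{\mathrm T}$: a positive constant depending only on $d$ and $S$ such that, for $\tanh$ features with $k_j\in[-S,S]^d$ and $v_j\in\mathbb R$, one has $\sigma_m\lesssim_{\Omega,d,\{\Lambda_i\},S}\sqrt{nN}\exp(-a_{\mathrm T}M^{1/d})$ for all $M$ sufficiently large in terms of $d,S$ and all integers $m$ with $3M\ln(15M)+1\le m\le2N$ (such a constant exists). *)

(* Defs.v *)
From HB Require Import structures.
From mathcomp Require Import all_boot all_order all_algebra.
From mathcomp Require Import all_classical all_reals all_analysis.

Set Implicit Arguments.
Unset Strict Implicit.
Unset Printing Implicit Defensive.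

Import Order.TTheory GRing.Theory Num.Theory.
Import numFieldNormedType.Exports.

Local Open Scope classical_set_scope.
Local Open Scope ring_scope.

(* Points of R^d are row vectors. The library norm `|x| on 'rV[R]_d is the sup
   norm, so the Euclidean norm and the spectral norm are defined here. *)

Definition dotv (R : realType) (d : nat) (u v : 'rV[R]_d) : R :=
  \sum_(i < d) u 0 i * v 0 i.

Definition enorm (R : realType) (d : nat) (u : 'rV[R]_d) : R :=
  Num.sqrt (dotv u u).

(* The quantity xi^T A xi, for xi a row vector. *)
Definition qform (R : realType) (d : nat) (A : 'M[R]_d) (xi : 'rV[R]_d) : R :=
  \sum_(i < d) \sum_(j < d) xi 0 i * A i j * xi 0 j.

(* With row vectors, the column vector A xi is the row vector xi *m A^T. *)
Definition specnorm (R : realType) (d : nat) (A : 'M[R]_d) : R :=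
  sup [set enorm (xi *m A^T) | xi in [set xi : 'rV[R]_d | enorm xi <= 1]].

Definition tanh (R : realType) (t : R) : R :=
  (expR t - expR (- t)) / (expR t + expR (- t)).

(* s lists the singular values of A, in nonincreasing order and with
   multiplicity: the square roots of the n eigenvalues of A^T A (for m < n the
   list ends with n - m zeros; only n <= m occurs below). *)
Definition singular_values (R : realType) (m n : nat) (A : 'M[R]_(m, n))
    (s : seq R) : Prop :=
  [/\ sorted >=%R s, {in s, forall t, 0 <= t}
    & char_poly (A^T *m A) = \prod_(t <- s) ('X - (t ^+ 2)%:P)].

(* sigma_m, numbered from 1. *)
Definition sing (R : realType) (s : seq R) (m : nat) : R := s`_m.-1.

Definition sing_ratio (R : realType) (s : seq R) (m : nat) : \bar R :=
  if sing s m == 0 then +oo%E else (sing s 1 / sing s m)%:E.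

Definition bdry (T : topologicalType) (O : set T) : set T :=
  closure O `\` interior O.

(* In the orthonormal coordinates y = x Q, and in the cube of half-side r around
   z, O is the region above the graph of the Lipschitz function phi, the vertical
   coordinate being the j-th one; col' j y is y with that coordinate removed. *)
Definition lipschitz_chart (R : realType) (d : nat) (O : set 'rV[R]_d)
    (z : 'rV[R]_d) (j : 'I_d) (Q : 'M[R]_d) (phi : 'rV[R]_d.-1 -> R) (r : R)
    : Prop :=
  [/\ Q *m Q^T = 1%:M,
      exists K : R, K.-lipschitz phi,
      0 < r
    & forall x : 'rV[R]_d, ball z r x ->
        (O x <-> phi (col' j (x *m Q)) < (x *m Q) 0 j)].

Definition lipschitz_domain (R : realType) (d : nat) (O : set 'rV[R]_d) : Prop :=
  [/\ open O, connected O, O !=set0, bounded_set O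
    & forall z, bdry O z -> exists j Q phi r, lipschitz_chart O z j Q phi r].

(* In chart coordinates (gradient of phi, -1) points downwards, i.e. out of O. *)
Definition downward (R : realType) (d : nat) (j : 'I_d) (phi : 'rV[R]_d.-1 -> R)
    (p : 'rV[R]_d.-1) : 'rV[R]_d :=
  \row_(i < d) (if unlift j i is Some l then 'D_(delta_mx 0 l) phi p else -1).

Definition outward_normal (R : realType) (d : nat) (O : set 'rV[R]_d)
    (z nu : 'rV[R]_d) : Prop :=
  exists j Q phi r,
    [/\ lipschitz_chart O z j Q phi r,
        differentiable phi (col' j (z *m Q))
      & let w := downward j phi (col' j (z *m Q)) in
        nu = (enorm w)^-1 *: (w *m Q^T)].

(* The unit outward normal field; it is 0 where no normal exists. *)
Definition normal (R : realType) (d : nat) (O : set 'rV[R]_d) (z : 'rV[R]_d)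
    : 'rV[R]_d :=
  xget 0 [set nu | outward_normal O z nu].

Record coeffs (R : realType) (d : nat) := Coeffs {
  cA : 'rV[R]_d -> 'M[R]_d;
  cb : 'rV[R]_d -> 'rV[R]_d;
  cc : 'rV[R]_d -> R;
  cg1 : 'rV[R]_d -> R;
  cg2 : 'rV[R]_d -> R }.

Definition opL (R : realType) (d : nat) (P : coeffs R d) (u : 'rV[R]_d -> R)
    (x : 'rV[R]_d) : R :=
  \sum_(k < d) \sum_(l < d)
     cA P x k l * 'D_(delta_mx 0 k) (fun y => 'D_(delta_mx 0 l) u y) x
  + \sum_(k < d) cb P x 0 k * 'D_(delta_mx 0 k) u x
  + cc P x * u x.

Definition opB (R : realType) (d : nat) (O : set 'rV[R]_d) (P : coeffs R d)
    (u : 'rV[R]_d -> R) (x : 'rV[R]_d) : R :=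
  cg1 P x * 'D_(normal O x) u x + cg2 P x * u x.

Definition opLtilde (R : realType) (d : nat) (O : set 'rV[R]_d) (P : coeffs R d)
    (u : 'rV[R]_d -> R) (x : 'rV[R]_d) : R :=
  if x \in O then opL P u x else opB O P u x.

Definition bounded_coeffs (R : realType) (d : nat) (O : set 'rV[R]_d)
    (L1 L2 L3 L4 L5 : R) (P : coeffs R d) : Prop :=
  (forall x, O x ->
     [/\ (cA P x)^T = cA P x, specnorm (cA P x) <= L1,
         enorm (cb P x) <= L2 & `|cc P x| <= L3]) /\
  (forall x, bdry O x -> `|cg1 P x| <= L4 /\ `|cg2 P x| <= L5).

Definition collocation (R : realType) (d : nat) (O : set 'rV[R]_d) (n1 n2 : nat)
    (x : 'I_(n1 + n2) -> 'rV[R]_d) : Prop :=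
  (forall i : 'I_n1, O (x (lshift n2 i))) /\
  (forall i : 'I_n2, bdry O (x (rshift n1 i)) /\
     exists nu, outward_normal O (x (rshift n1 i)) nu).

Definition in_cube (R : realType) (d : nat) (S : R) (k : 'rV[R]_d) : Prop :=
  forall l : 'I_d, - S <= k 0 l <= S.

Definition fourier_features (R : realType) (d N : nat) (k : 'I_N -> 'rV[R]_d)
    (j : 'I_(N + N)) (x : 'rV[R]_d) : R :=
  match fintype.split j with
  | inl i => cos (dotv (k i) x)
  | inr i => sin (dotv (k i) x)
  end.

Definition tanh_features (R : realType) (d p : nat) (k : 'I_p -> 'rV[R]_d)
    (v : 'I_p -> R) (j : 'I_p) (x : 'rV[R]_d) : R :=
  tanh (dotv (k j) x + v j).

Definition feature_mx (R : realType) (d n p : nat) (O : set 'rV[R]_d)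
    (P : coeffs R d) (psi : 'I_p -> 'rV[R]_d -> R) (x : 'I_n -> 'rV[R]_d)
    : 'M[R]_(n, p) :=
  \matrix_(i < n, j < p) opLtilde O P (psi j) (x i).

Definition good_domain (R : realType) (d : nat) (O : set 'rV[R]_d) : Prop :=
  lipschitz_domain O /\ (forall x, O x -> forall i : 'I_d, -1 < x 0 i < 1).

(* The property defining the constant a_T(d, S). The threshold M0 is chosen before
   the domain and the bounds, the constant C after them. *)
Definition tanh_decay_constant (R : realType) (d : nat) (S aT : R) : Prop :=
  0 < aT /\
  exists M0 : R, forall (O : set 'rV[R]_d) (L1 L2 L3 L4 L5 : R),
    good_domain O ->
    0 < L1 -> 0 < L2 -> 0 < L3 -> 0 < L4 -> 0 < L5 ->
    exists2 C : R, 0 < C &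
      forall (P : coeffs R d) (n1 n2 N : nat) (x : 'I_(n1 + n2) -> 'rV[R]_d)
             (k : 'I_(N + N) -> 'rV[R]_d) (v : 'I_(N + N) -> R)
             (s : seq R) (M : R) (m : nat),
        bounded_coeffs O L1 L2 L3 L4 L5 P ->
        (0 < n1)%N -> (0 < n2)%N -> (N + N < n1 + n2)%N ->
        collocation O x ->
        (forall j, in_cube S (k j)) ->
        singular_values (feature_mx O P (tanh_features k v) x) s ->
        0 < M -> M0 <= M ->
        (0 < m)%N -> 3 * M * ln (15 * M) + 1 <= m%:R -> (m <= N + N)%N ->
        sing s m <=
          C * Num.sqrt ((n1 + n2)%:R * N%:R) * expR (- aT * M `^ d%:R^-1).

Definition elliptic (R : realType) (d : nat) (O : set 'rV[R]_d) (P : coeffs R d)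
    (alow : R) : Prop :=
  forall x, O x ->
    (forall xi, alow * enorm xi ^+ 2 <= - qform (cA P x) xi) /\ 0 <= cc P x.

(* max_i theta^T x_i - min_i theta^T x_i; sup and inf are over a finite set. *)
Definition width (R : realType) (d n : nat) (x : 'I_n -> 'rV[R]_d)
    (theta : 'rV[R]_d) : R :=
  sup (range (fun i => dotv theta (x i))) -
  inf (range (fun i => dotv theta (x i))).

Definition min_width (R : realType) (d n : nat) (x : 'I_n -> 'rV[R]_d) : R :=
  inf [set width x theta | theta in [set theta : 'rV[R]_d | enorm theta = 1]].

Definition aF (R : realType) (d : nat) : R :=
  3 * 2 `^ (1 - d%:R^-1) / (112 * expR 1).

(* Main.v *)
Require Import Defs.
From HB Require Import structures.
From mathcomp Require Import all_boot all_order all_algebra.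
From mathcomp Require Import all_classical all_reals all_analysis.
From mathcomp Require Import ring lra.

(** The smallest singular value is small because the features are nearly
    polynomial. Expanding each feature to order [D] in the phase [k.x], a nonzero
    combination of the [2N] columns annihilates all coefficients of the [D^d]
    monomials as soon as [D^d < 2N], and what is left of [Psi w] is a Taylor
    remainder. Since [2N - 1 >= 3 M ln (15 M)], one may take [D] equal to any
    fixed multiple of [M^(1/d)], so the remainder beats the stated rates for large
    [M]; it also carries a factor [K^D], where [K] is the largest frequency.

    The largest singular value is bounded below by the columns (Fourier) or one
    entry (tanh) of the largest frequency, which gives the powers [K^2] and [K^3]
    respectively. These are absorbed by the factor [K^D] above, except for tanh
    features with [K] bounded below, where the decay constant [aT] is used. *)

Set Implicit Arguments.
Unset Strict Implicit.
Unset Printing Implicit Defensive.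

Import Order.TTheory GRing.Theory Num.Theory.
Import numFieldNormedType.Exports.

Local Open Scope classical_set_scope.
Local Open Scope ring_scope.

Lemma sumr_ord (V : nmodType) n (a : V) : \sum_(i < n) a = a *+ n.
Proof. by rewrite sumr_const card_ord. Qed.

(** * Euclidean inner product and norm of row vectors *)

Section Dot.
Variables (R : realType) (d : nat).
Implicit Types (u v w : 'rV[R]_d) (a : R).

Lemma dotvE u v : dotv u v = (u *m v^T) 0 0.
Proof. by rewrite mxE; apply: eq_bigr => i _; rewrite mxE. Qed.

Lemma dotvC u v : dotv u v = dotv v u.
Proof. by apply: eq_bigr => i _; rewrite mulrC. Qed.

Lemma dotvDl u v w : dotv (u + v) w = dotv u w + dotv v w.
Proof. by rewrite !dotvE mulmxDl mxE. Qed.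

Lemma dotvZl a u v : dotv (a *: u) v = a * dotv u v.
Proof. by rewrite !dotvE -scalemxAl mxE. Qed.

Lemma dotvDr u v w : dotv w (u + v) = dotv w u + dotv w v.
Proof. by rewrite dotvC dotvDl !(dotvC w). Qed.

Lemma dotvZr a u v : dotv v (a *: u) = a * dotv v u.
Proof. by rewrite dotvC dotvZl dotvC. Qed.

Lemma dotv0l u : dotv 0 u = 0.
Proof. by rewrite -(scale0r 0) dotvZl mul0r. Qed.

Lemma dotvNl u v : dotv (- u) v = - dotv u v.
Proof. by rewrite -scaleN1r dotvZl mulN1r. Qed.

Lemma dotv_ge0 u : 0 <= dotv u u.
Proof. by apply: sumr_ge0 => i _; rewrite -expr2 sqr_ge0. Qed.

Lemma dotv_eq0 u : (dotv u u == 0) = (u == 0).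
Proof.
rewrite psumr_eq0; last by move=> i _; rewrite -expr2 sqr_ge0.
apply/idP/eqP => [/allP u0|->]; last by apply/allP => i _; rewrite mxE mulr0 eqxx.
apply/rowP => i; rewrite mxE; have /= := u0 i (mem_index_enum i).
by rewrite mulf_eq0 orbb => /eqP.
Qed.

Lemma dotv_delta u (i : 'I_d) : dotv u (delta_mx 0 i) = u 0 i.
Proof.
rewrite /dotv (bigD1 i) //= big1 ?addr0 => [|j /negPf ji]; rewrite mxE !eqxx ?mulr1 //.
by rewrite ji mulr0.
Qed.

Lemma enorm_ge0 u : 0 <= enorm u.
Proof. exact: sqrtr_ge0. Qed.

Lemma sqr_enorm u : enorm u ^+ 2 = dotv u u.
Proof. by rewrite sqr_sqrtr // dotv_ge0. Qed.

Lemma enormZ a u : enorm (a *: u) = `|a| * enorm u.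
Proof. by rewrite /enorm dotvZl dotvZr mulrA -expr2 sqrtrM ?sqr_ge0 // sqrtr_sqr. Qed.

Lemma enorm_delta (i : 'I_d) : enorm (delta_mx 0 i : 'rV[R]_d) = 1.
Proof. by rewrite /enorm dotv_delta mxE !eqxx sqrtr1. Qed.

Lemma coord_le_enorm u (i : 'I_d) : `|u 0 i| <= enorm u.
Proof.
rewrite -sqrtr_sqr ler_sqrt ?dotv_ge0 // /dotv (bigD1 i) //= expr2 lerDl.
by apply: sumr_ge0 => j _; rewrite -expr2 sqr_ge0.
Qed.

Lemma coord_le_norm u (i : 'I_d) : `|u 0 i| <= `|u|.
Proof.
rewrite /Num.norm/= mx_normrE; apply: (bigmax_sup (0, i)) => //=.
Qed.

Lemma norm_le_enorm u : `|u| <= enorm u.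
Proof.
rewrite {1}/Num.norm/= mx_normrE; apply/bigmax_leP; split; first exact: enorm_ge0.
by case=> i j _ /=; rewrite ord1 coord_le_enorm.
Qed.

Lemma norm_dotv_le u v (a b : R) : 0 <= a ->
  (forall i, `|u 0 i| <= a) -> (forall i, `|v 0 i| <= b) ->
  `|dotv u v| <= d%:R * (a * b).
Proof.
move=> a0 ua vb; apply: (le_trans (ler_norm_sum _ _ _)).
rewrite mulr_natl -sumr_ord; apply: ler_sum => i _.
by rewrite normrM ler_pM.
Qed.

End Dot.

(** * Extremal eigenvalues of symmetric matrices through Rayleigh quotients *)

Section Rayleigh.
Variables (R : realType) (p : nat).
Implicit Types (G : 'M[R]_p) (u v : 'rV[R]_p).

Lemma dotv_mulmx_sym G u v : G^T = G -> dotv (u *m G) v = dotv (v *m G) u.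
Proof.
by move=> sG; rewrite dotvC !dotvE trmx_mul sG mulmxA.
Qed.

Lemma continuous_dotv_mulmx G : continuous (fun u => dotv (u *m G) u).
Proof.
have cG i : continuous (fun v : 'rV[R]_p => (v *m G) 0 i).
  have -> : (fun v : 'rV[R]_p => (v *m G) 0 i) = fun v => \sum_j v 0 j * G j i.
    by apply/funext => v; rewrite mxE.
  apply: (continuous_big (op := +%R)); first exact: add_continuous.
  move=> j _ u; exact: (cvgMr_tmp (@coord_continuous R 1 p 0 j u)).
apply: (continuous_big (op := +%R)); first exact: add_continuous.
move=> i _ u; exact: (cvgM (cG i u) (@coord_continuous R 1 p 0 i u)).
Qed.

Lemma compact_unit_sphere : compact [set u : 'rV[R]_p | dotv u u = 1].
Proof.
apply: bounded_closed_compact.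
  exists 1; split=> // x x1 u /= u1; apply: le_trans (ltW x1).
  by apply: (le_trans (norm_le_enorm u)); rewrite /enorm u1 sqrtr1.
have -> : [set u : 'rV[R]_p | dotv u u = 1] =
    (fun u => dotv (u *m 1%:M) u) @^-1` [set 1].
  by apply/seteqP; split=> u /=; rewrite mulmx1.
apply: closed_comp => [u _|]; [exact: continuous_dotv_mulmx | exact: closed_eq].
Qed.

(* A minimizer w of the Rayleigh quotient lies in the kernel of the positive
   semidefinite matrix G - lam: a small step from w along - w (G - lam) would
   otherwise make that form negative. *)
Lemma min_eigenvalue G : (0 < p)%N -> G^T = G ->
  exists2 lam, eigenvalue G lam & forall u, lam * dotv u u <= dotv (u *m G) u.
Proof.
move=> p0 sG.
have S0 : [set u : 'rV[R]_p | dotv u u = 1] !=set0.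
  by exists (delta_mx 0 (Ordinal p0)); rewrite /= dotv_delta mxE !eqxx.
have [w wS wmin] := EVT_min_rV S0 compact_unit_sphere
  (continuous_subspaceT (@continuous_dotv_mulmx G)).
rewrite inE /= in wS; set lam := dotv (w *m G) w.
have lamP u : lam * dotv u u <= dotv (u *m G) u.
  have [->|u0] := eqVneq u 0; first by rewrite mul0mx !dotv0l mulr0.
  have du : 0 < dotv u u by rewrite lt_neqAle eq_sym dotv_eq0 u0 dotv_ge0.
  have e0 : enorm u != 0 by rewrite sqrtr_eq0 -ltNge.
  have dn : dotv ((enorm u)^-1 *: u) ((enorm u)^-1 *: u) = 1.
    by rewrite dotvZl dotvZr -sqr_enorm; field.
  have := wmin ((enorm u)^-1 *: u); rewrite !inE /= => /(_ dn).
  rewrite -scalemxAl dotvZl dotvZr mulrA -expr2 exprVn mulrC.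
  by rewrite ler_pdivlMr sqr_enorm.
exists lam => //; apply/eigenvalueP; exists w; last first.
  by rewrite -dotv_eq0 wS oner_eq0.
apply/eqP; rewrite -subr_eq0 -dotv_eq0; set h := _ - _.
have hE : dotv h h = dotv (w *m G) h - lam * dotv w h.
  by rewrite {1}/h dotvDl dotvNl dotvZl.
clearbody h.
(* Nonnegativity of [G - lam] at [w + t *: h]: the constant term vanishes because [w] attains the
   minimum, and symmetry makes both cross terms equal to [dotv h h]. *)
have key (t : R) : 0 <= 2 * t * dotv h h + t ^+ 2 * (dotv (h *m G) h - lam * dotv h h).
  have := lamP (w + t *: h).
  rewrite mulmxDl -scalemxAl !(dotvDl, dotvDr, dotvZl, dotvZr) wS -/lam.
  rewrite (dotvC h w) (dotv_mulmx_sym h w sG) hE -subr_ge0.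
  by move/le_trans; apply; rewrite le_eqVlt; apply/orP; left; apply/eqP; ring.
have h0 := dotv_ge0 h; set c := dotv (h *m G) h - _ in key.
apply/negPn/negP => hn.
have hp : 0 < dotv h h by rewrite lt_neqAle eq_sym hn h0.
have k0 : 0 < `|c| + 1 by rewrite ltr_wpDl.
(* Scaling the step by [|c| + 1] keeps the quadratic term from compensating the linear one: the
   value is a positive square times [c - 2 (|c| + 1) < 0]. *)
have := key (- (dotv h h / (`|c| + 1))).
have -> : 2 * - (dotv h h / (`|c| + 1)) * dotv h h + (- (dotv h h / (`|c| + 1))) ^+ 2 * c
   = (dotv h h / (`|c| + 1)) ^+ 2 * (c - 2 * (`|c| + 1)).
  by field; rewrite gt_eqF.
rewrite pmulr_rge0 ?exprn_gt0 ?divr_gt0 // subr_ge0 leNgt => /negP; apply.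
have := ler_norm c; have := normr_ge0 c; lra.
Qed.

Lemma max_eigenvalue G : (0 < p)%N -> G^T = G ->
  exists2 lam, eigenvalue G lam & forall u, dotv (u *m G) u <= lam * dotv u u.
Proof.
move=> p0 sG; have [|lam /eigenvalueP[v vG v0] lamP] := @min_eigenvalue (- G) p0.
  by rewrite linearN /= sG.
exists (- lam).
  by apply/eigenvalueP; exists v => //; rewrite scaleNr -vG mulmxN opprK.
by move=> u; have := lamP u; rewrite mulmxN dotvNl mulNr lerNr.
Qed.

End Rayleigh.

(** * Variational bounds for the first and last singular values *)

Section SingularValues.
Variables (R : realType) (m n : nat) (A : 'M[R]_(m, n)) (s : seq R).
Hypothesis sA : singular_values A s.

Lemma size_singular_values : size s = n.
Proof.
have [_ _ /(congr1 (fun q : {poly R} => size q))] := sA.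
by rewrite size_char_poly size_prod_XsubC => -[].
Qed.

Lemma eigenvalue_singular lam : eigenvalue (A^T *m A) lam ->
  exists2 t, t \in s & lam = t ^+ 2.
Proof.
have [_ _ cA] := sA; rewrite eigenvalue_root_char cA.
have -> : \prod_(t <- s) ('X - (t ^+ 2)%:P) =
    \prod_(t <- [seq t ^+ 2 | t <- s]) ('X - t%:P) by rewrite big_map.
by rewrite root_prod_XsubC => /mapP.
Qed.

Lemma sing_ge0 i : 0 <= sing s i.
Proof.
have [_ s0 _] := sA; rewrite /sing; have [lt_is|] := ltnP i.-1 (size s).
  exact/s0/mem_nth.
by move=> ?; rewrite nth_default.
Qed.

Lemma sing_bounds t : t \in s -> sing s n <= t <= sing s 1.
Proof.
move=> ts; have [ss _ _] := sA; rewrite /sing -size_singular_values /=.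
have it : (index t s < size s)%N by rewrite index_mem.
have ge_tr : transitive (>=%R : rel R) by move=> y x z /= yx zy; exact: le_trans yx.
have mono := sorted_leq_nth ge_tr (fun x : R => lexx x) 0 ss.
rewrite -(nth_index 0 ts); apply/andP; split.
  by apply: mono; rewrite ?inE //; case: (size s) it => //= k; rewrite ltnS.
by apply: mono; rewrite ?inE //; apply: leq_ltn_trans it.
Qed.

Lemma dotv_gram (u : 'rV[R]_n) :
  dotv (u *m (A^T *m A)) u = dotv (u *m A^T) (u *m A^T).
Proof. by rewrite !dotvE trmx_mul trmxK !mulmxA. Qed.

Hypothesis n0 : (0 < n)%N.

Let gram_sym : (A^T *m A)^T = A^T *m A.
Proof. by rewrite trmx_mul trmxK. Qed.

(** The minimum of the Rayleigh quotient of [A^T A] is an eigenvalue, hence the square of an entry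
    of [s], and every entry is at least [sing s n]. *)
Lemma sing_last_le (u : 'rV[R]_n) : sing s n * enorm u <= enorm (u *m A^T).
Proof.
have [lam /eigenvalue_singular[t ts ->] tP] := min_eigenvalue n0 gram_sym.
have /andP[st _] := sing_bounds ts.
rewrite -ler_sqr ?nnegrE ?mulr_ge0 ?enorm_ge0 ?sing_ge0 //.
rewrite exprMn !sqr_enorm -dotv_gram; apply: le_trans (tP u).
by rewrite ler_wpM2r ?dotv_ge0 // ler_sqr ?nnegrE ?sing_ge0 // (le_trans _ st) ?sing_ge0.
Qed.

Lemma sing_first_ge (u : 'rV[R]_n) : enorm (u *m A^T) <= sing s 1 * enorm u.
Proof.
have [lam /eigenvalue_singular[t ts ->] tP] := max_eigenvalue n0 gram_sym.
have /andP[st st1] := sing_bounds ts.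
rewrite -ler_sqr ?nnegrE ?mulr_ge0 ?enorm_ge0 ?sing_ge0 //.
rewrite exprMn !sqr_enorm -dotv_gram; apply: le_trans (tP u) _.
by rewrite ler_wpM2r ?dotv_ge0 // ler_sqr ?nnegrE ?sing_ge0 // (le_trans _ st) ?sing_ge0.
Qed.

Lemma sing_first_col (j : 'I_n) : \sum_i A i j ^+ 2 <= sing s 1 ^+ 2.
Proof.
have := sing_first_ge (delta_mx 0 j); rewrite enorm_delta mulr1.
rewrite -ler_sqr ?nnegrE ?enorm_ge0 ?sing_ge0 // sqr_enorm; apply: le_trans.
rewrite le_eqVlt; apply/orP; left; apply/eqP; apply: eq_bigr => i _.
by rewrite -rowE !mxE expr2.
Qed.

Lemma sing_first_entry (i : 'I_m) (j : 'I_n) : `|A i j| <= sing s 1.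
Proof.
rewrite -ler_sqr ?nnegrE ?sing_ge0 ?normr_ge0 // real_normK ?num_real //.
apply: le_trans (sing_first_col j); rewrite (bigD1 i) //= lerDl.
by apply: sumr_ge0 => k _; rewrite sqr_ge0.
Qed.

(* By Cauchy-Schwarz, [enorm (u A^T) <= sqrt m * sqrt n * e * enorm u]. *)
Lemma sing_last_le_err (u : 'rV[R]_n) (e : R) : u != 0 -> 0 <= e ->
  (forall i, `|(u *m A^T) 0 i| <= (\sum_j `|u 0 j|) * e) ->
  sing s n <= Num.sqrt (m%:R * n%:R) * e.
Proof.
move=> u0 e0 ue.
have du : 0 < enorm u by rewrite lt_neqAle enorm_ge0 andbT eq_sym sqrtr_eq0 -ltNge
  lt_neqAle eq_sym dotv_eq0 u0 dotv_ge0.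
rewrite -(ler_pM2r du) (le_trans (sing_last_le u)) //.
rewrite -ler_sqr ?nnegrE ?mulr_ge0 ?enorm_ge0 ?sqrtr_ge0 //.
rewrite !exprMn !sqr_enorm sqr_sqrtr ?mulr_ge0 //.
have CS : (\sum_j `|u 0 j|) ^+ 2 <= n%:R * dotv u u.
  (* This double sum equals [2 n |u|^2 - 2 (sum_j |u_j|)^2], with [|u|] the Euclidean norm. *)
  suff : 0 <= \sum_i \sum_j (`|u 0 i| - `|u 0 j|) ^+ 2.
    have -> : \sum_i \sum_j (`|u 0 i| - `|u 0 j|) ^+ 2 =
        \sum_i (n%:R * (u 0 i * u 0 i) - 2 * (`|u 0 i| * (\sum_j `|u 0 j|)) + dotv u u).
      apply: eq_bigr => i _; rewrite [in RHS]mulr_sumr mulr_sumr.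
      rewrite [n%:R * _]mulr_natl -sumr_ord -sumrB -big_split /=.
      apply: eq_bigr => j _.
      rewrite sqrrB !real_normK ?num_real // !expr2; ring.
    rewrite big_split /= sumrB -!mulr_sumr -mulr_suml sumr_ord -mulr_natl.
    rewrite -/(dotv u u); nra.
  by apply: sumr_ge0 => i _; apply: sumr_ge0 => j _; rewrite sqr_ge0.
apply: (@le_trans _ _ (m%:R * ((\sum_j `|u 0 j|) * e) ^+ 2)).
  rewrite mulr_natl -sumr_ord; apply: ler_sum => i _.
  rewrite -expr2 -real_normK ?num_real // ler_sqr ?nnegrE // mulr_ge0 //.
  exact: sumr_ge0.
rewrite exprMn [leRHS](_ : _ = m%:R * (n%:R * dotv u u * e ^+ 2)); last by ring.
by rewrite ler_wpM2l // ler_wpM2r ?sqr_ge0.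
Qed.

End SingularValues.

(** * Combinations of features that annihilate all low-degree monomials *)

(** More unknowns than equations: the matrix of [c] has [p] rows and only [#|T|] columns, so its
    left kernel is nonzero. Below, [T] is the box of exponents ['I_d -> 'I_D], of cardinality
    [D ^ d]. *)
Lemma exists_annihilator (F : fieldType) (T : finType) p (c : 'I_p -> T -> F) :
  (#|T| < p)%N ->
  exists2 w : 'rV[F]_p, w != 0 & forall a, \sum_j w 0 j * c j a = 0.
Proof.
move=> Tp; pose M := \matrix_(j < p, l < #|T|) c j (enum_val l).
have : kermx M != 0.
  rewrite -mxrank_eq0 mxrank_ker subn_eq0 -ltnNge.
  by apply: leq_ltn_trans (rank_leq_col M) Tp.
case/rowV0Pn => w /sub_kermxP wM w0; exists w => // a.
have /rowP/(_ (enum_rank a)) := wM; rewrite !mxE => wa; rewrite -[RHS]wa.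
by apply: eq_bigr => j _; rewrite !mxE enum_rankK.
Qed.

Section Annihilator.
Variables (R : realType) (d p D : nat).
Variables (k : 'I_p -> 'rV[R]_d) (t : 'I_p -> nat -> R) (w : 'rV[R]_p).
Hypothesis wP : forall a : {ffun 'I_d -> 'I_D},
  \sum_j w 0 j * (t j (\sum_i a i)%N * \prod_i k j 0 i ^+ a i) = 0.

(* Expanded, the product of linear forms is a combination of the monomials
   [prod_i k_i ^ a_i] with [a_i <= m < D], whose coefficients do not depend on j. *)
Lemma annihilator_prod_dotv m (y : nat -> 'rV[R]_d) : (m < D)%N ->
  \sum_j w 0 j * (t j m * \prod_(l < m) dotv (k j) (y l)) = 0.
Proof.
move=> mD.
(* [g f] is the exponent of the monomial selected by [f]: it counts the factors [l] with [f l = i].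
   There are at most [m < D] of them, so the count fits in ['I_D]. *)
pose g (f : {ffun 'I_m -> 'I_d}) := [ffun i => Ordinal
  (leq_ltn_trans (leq_trans (max_card [pred l | f l == i])
     (eq_leq (card_ord m))) mD)].
have gE (f : {ffun 'I_m -> 'I_d}) j :
    \prod_l k j 0 (f l) = \prod_i k j 0 i ^+ g f i.
  rewrite (partition_big f xpredT) //=; apply: eq_bigr => i _.
  rewrite ffunE /= -prodr_const; apply: eq_bigr => l /eqP -> //.
have gs (f : {ffun 'I_m -> 'I_d}) : (\sum_i g f i)%N = m.
  rewrite -[RHS]card_ord -sum1_card (partition_big f xpredT) //=.
  by apply: eq_bigr => i _; rewrite ffunE /= sum1_card.
have dE j : \prod_(l < m) dotv (k j) (y l) =
    \sum_(f : {ffun 'I_m -> 'I_d})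
      (\prod_(l < m) y l 0 (f l)) * \prod_i k j 0 i ^+ g f i.
  rewrite /dotv bigA_distr_bigA; apply: eq_bigr => f _.
  by rewrite -gE big_split mulrC.
under eq_bigr do rewrite dE !mulr_sumr.
rewrite exchange_big big1 //= => f _.
transitivity (\prod_(l < m) y l 0 (f l) *
  \sum_j w 0 j * (t j (\sum_i g f i)%N * \prod_i k j 0 i ^+ g f i)).
  by rewrite gs mulr_sumr; apply: eq_bigr => j _; ring.
by rewrite wP mulr0.
Qed.

End Annihilator.

(** * Taylor expansion with a remainder bound *)

Section Taylor.
Variable R : realType.
Implicit Types (F : nat -> R -> R) (g : R -> R).

(** A smooth function is carried together with explicit formulas for all its derivatives, so that
    bounds on the derivative of order [D] are read off a closed form or a recursion. *)
Definition derivative_tower F :=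
  forall m t, is_derive t (1 : R) (F m) (F m.+1 t).

Lemma ge0_of_derive_ge0 g g' (x : R) : g 0 = 0 ->
  (forall t : R, is_derive t (1 : R) g (g' t)) ->
  (forall t, 0 <= t -> 0 <= g' t) -> 0 <= x -> 0 <= g x.
Proof.
move=> g0 gd g'0 x0.
have [|c cx] := @MVT_segment R g g' 0 x x0 (fun t _ => gd t).
  apply: continuous_subspaceT => t.
  by apply: differentiable_continuous; apply/derivable1_diffP; have [] := gd t.
rewrite g0 !subr0 => ->; rewrite mulr_ge0 // g'0 //.
by move: cx; rewrite in_itv => /andP[].
Qed.

(** Induction on [n] for all [m] at once: the remainder of [F m] at order [n.+1] has as derivative
    the remainder of [F m.+1] at order [n]. With [X] the primitive of the earlier bound, [X] plus or
    minus the remainder vanishes at 0 and has nonnegative derivative. *)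
Lemma taylor_right F m n (B : R) : derivative_tower F ->
  (forall t, `|F (m + n)%N t| <= B) -> forall t, 0 <= t ->
  `|F m t - (\poly_(q < n) (F (m + q)%N 0 / q`!%:R)).[t]| <= B * (t ^+ n / n`!%:R).
Proof.
move=> dF; elim: n m => [|n IHn] m FB t t0.
  by rewrite horner_poly big_ord0 subr0 expr0 fact0 divr1 mulr1 -[m]addn0.
set T := fun m n => \poly_(q < n) (F (m + q)%N 0 / q`!%:R).
pose X : {poly R} := (B / n.+1`!%:R) *: 'X^(n.+1).
have dX : X^`() = (B / n`!%:R) *: 'X^n.
  rewrite /X derivZ derivXn /= -['X^n *+ _]scaler_nat scalerA; congr (_ *: _).
  rewrite factS natrM; field.
  by rewrite nat1r !pnatr_eq0 -lt0n fact_gt0.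
have dT : (T m n.+1)^`() = T m.+1 n.
  apply/polyP => q; rewrite coef_deriv !coef_poly ltnS; case: ifP; rewrite ?mul0rn // => _.
  rewrite factS natrM -mulr_natr addnS addSn; field.
  by rewrite nat1r !pnatr_eq0 -lt0n fact_gt0.
have IH u : 0 <= u -> `|F m.+1 u - (T m.+1 n).[u]| <= (X^`()).[u].
  move=> u0; rewrite dX hornerZ hornerXn mulrAC -mulrA; apply: IHn => // z.
  by rewrite addSnnS.
have T0 : (T m n.+1).[0] = F m 0.
  rewrite horner_poly big_ord_recl /= expr0 fact0 divr1 mulr1 addn0 big1 ?addr0 //.
  by move=> q _; rewrite exprS mul0r mulr0.
have X0 : X.[0] = 0 by rewrite hornerZ hornerXn exprS mul0r mulr0.
have XE : X.[t] = B * (t ^+ n.+1 / n.+1`!%:R).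
  by rewrite hornerZ hornerXn mulrAC -mulrA.
rewrite -XE ler_norml; apply/andP; split.
  rewrite -subr_ge0 opprK.
  apply: (@ge0_of_derive_ge0 (fun u => F m u - (T m n.+1).[u] + X.[u])
     (fun u => F m.+1 u - (T m.+1 n).[u] + (X^`()).[u]) _) => //.
  - by rewrite T0 X0 addr0 subrr.
  - by move=> u; have dFu := dF m u; rewrite -dT; exact: is_deriveD.
  - by move=> u u0; have := IH u u0; rewrite ler_norml => /andP[+ _]; lra.
rewrite -subr_ge0.
apply: (@ge0_of_derive_ge0 (fun u => X.[u] - (F m u - (T m n.+1).[u]))
   (fun u => (X^`()).[u] - (F m.+1 u - (T m.+1 n).[u])) _) => //.
- by rewrite T0 X0 subrr subr0.
- by move=> u; have dFu := dF m u; rewrite -dT; exact: is_deriveB.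
- by move=> u u0; have := IH u u0; rewrite ler_norml => /andP[_ +]; lra.
Qed.

(** [taylor_right] is applied at time 1 to the tower [s ^+ q * F q (t * s + v)], which runs along
    the segment from [v] to [s + v] and so covers both signs of [s]. A common factor [s ^+ m] is
    then cancelled, whence the separate case [s = 0]. *)
Lemma taylor_bound F m n (B v s : R) : derivative_tower F ->
  (forall t, `|F (m + n)%N t| <= B) ->
  `|F m (s + v) - \sum_(q < n) F (m + q)%N v * (s ^+ q / q`!%:R)|
    <= B * (`|s| ^+ n / n`!%:R).
Proof.
move=> dF FB; pose G q t := s ^+ q * F q (t * s + v).
have dG : derivative_tower G.
  move=> q t; have dFq := dF q (t * s + v).
  have di : is_derive t (1 : R) (fun t : R => t * s + v) s.
    by apply: is_derive_eq; rewrite scaler0 add0r addr0 scaler1.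
  have dc := @is_derive1_comp _ (F q) (fun t => t * s + v) t _ _ dFq di.
  have dz : is_derive t (1 : R) (G q) (s ^+ q *: (F q.+1 (t * s + v) * s)).
    exact: is_deriveZ.
  by apply: (is_derive_eq dz); rewrite /G exprS /GRing.scale /=; ring.
have [s0|s0] := eqVneq s 0.
  subst s; case: n FB => [|n] FB.
    by rewrite big_ord0 subr0 !expr0 fact0 divr1 mulr1 -[m]addn0.
  rewrite big_ord_recl big1 => [|q _]; last by rewrite exprS mul0r mul0r mulr0.
  rewrite expr0 fact0 divr1 mulr1 addn0 addr0 add0r subrr.
  by rewrite normr0 exprS !(mul0r, mulr0).
have sm : 0 < `|s| ^+ m by rewrite exprn_gt0 // normr_gt0.
have GB t : `|G (m + n)%N t| <= `|s| ^+ m * `|s| ^+ n * B.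
  by rewrite normrM normrX exprD ler_wpM2l // mulr_ge0 // exprn_ge0.
have := taylor_right dG GB ler01.
rewrite horner_poly /G mul1r mul0r add0r expr1n.
have -> : \sum_(q < n) s ^+ (m + q) * F (m + q)%N v / q`!%:R * 1 ^+ q =
    s ^+ m * \sum_(q < n) F (m + q)%N v * (s ^+ q / q`!%:R).
  by rewrite mulr_sumr; apply: eq_bigr => q _; rewrite expr1n exprD; ring.
rewrite -mulrBr normrM normrX.
have -> : `|s| ^+ m * `|s| ^+ n * B * (1 / n`!%:R) =
  `|s| ^+ m * (B * (`|s| ^+ n / n`!%:R)) by ring.
by rewrite ler_pM2l.
Qed.

End Taylor.

(** * The operators applied to functions of a single linear phase *)

Section Ridge.
Variables (R : realType) (d : nat).
Implicit Types (k x y : 'rV[R]_d) (v : R).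

(** The difference quotients along [y] are those of [f] along the scalar [dotv k y], which linearity
    of the differential turns into a factor. *)
Lemma derive_ridge (f : R -> R) (f' : R) k v x y :
  is_derive (dotv k x + v) (1 : R) f f' ->
  'D_y (fun z => f (dotv k z + v)) x = dotv k y * f'.
Proof.
move=> df; set a := dotv k x + v in df *.
have -> : 'D_y (fun z => f (dotv k z + v)) x = 'D_(dotv k y) f a.
  rewrite /derive; apply: (congr1 (fun g => lim (g @ 0^'))); apply/funext => h /=.
  congr (_ *: (f _ - _)); rewrite dotvDr dotvZr /a /=; rewrite addrA //.
have fd : differentiable f a by apply/derivable1_diffP; case: df.
have <- : 'D_1 f a = f' by case: df.
by rewrite !deriveE // -[X in 'd f a X]mulr1 -/(_ *: (1 : R)) linearZ.
Qed.

(** The value of a second-order operator on [f (k.x + v)], where [f2], [f1], [f0] stand for [f''],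
    [f'], [f] at the phase. The boundary operator has the same form with [A = 0] and [b] a multiple
    of the normal, so all rows of the matrix are treated alike. *)
Definition ridge_symbol (A : 'M[R]_d) (b : 'rV[R]_d) (c : R) k (f2 f1 f0 : R) :=
  \sum_a \sum_e A a e * (k 0 a * k 0 e * f2) + \sum_a b 0 a * (k 0 a * f1) + c * f0.

Lemma opL_ridge (P : coeffs R d) (F : nat -> R -> R) k v x : derivative_tower F ->
  let z := dotv k x + v in
  opL P (fun y => F 0%N (dotv k y + v)) x =
    ridge_symbol (cA P x) (cb P x) (cc P x) k (F 2%N z) (F 1%N z) (F 0%N z).
Proof.
move=> dF z; rewrite /opL /ridge_symbol; congr (_ + _ + _).
  apply: eq_bigr => a _; apply: eq_bigr => e _; congr (_ * _).
  have -> : (fun y => 'D_(delta_mx 0 e) (fun y0 => F 0%N (dotv k y0 + v)) y) =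
      fun y => k 0 e * F 1%N (dotv k y + v).
    by apply/funext => y; rewrite (derive_ridge _ (dF 0%N _)) dotv_delta.
  have dF1 := dF 1%N z.
  have dk : is_derive z (1 : R) (fun u => k 0 e * F 1%N u) (k 0 e * F 2%N z).
    exact: (is_deriveZ (k 0 e)).
  by transitivity (dotv k (delta_mx 0 a) * (k 0 e * F 2%N z));
    [exact: derive_ridge | rewrite dotv_delta mulrA].
apply: eq_bigr => a _; congr (_ * _).
by rewrite (derive_ridge _ (dF 0%N _)) dotv_delta.
Qed.

Lemma opB_ridge (O : set 'rV[R]_d) (P : coeffs R d) (F : nat -> R -> R) k v x :
  derivative_tower F -> let z := dotv k x + v in
  opB O P (fun y => F 0%N (dotv k y + v)) x =
    ridge_symbol 0 (cg1 P x *: normal O x) (cg2 P x) k (F 2%N z) (F 1%N z) (F 0%N z).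
Proof.
move=> dF z; rewrite /opB /ridge_symbol (derive_ridge _ (dF 0%N _)); congr (_ + _).
rewrite big1 ?add0r => [|a _]; last by apply: big1 => e _; rewrite mxE mul0r.
rewrite /dotv mulr_suml mulr_sumr; apply: eq_bigr => a _.
by rewrite mxE; ring.
Qed.

End Ridge.

(** * Uniform bounds on coefficients and collocation points *)

Section CoefficientBounds.
Variables (R : realType) (d : nat).
Implicit Types (O : set 'rV[R]_d) (P : coeffs R d) (x : 'rV[R]_d).

(** The entry is a coordinate of the image of the unit vector [delta_mx 0 e]. *)
Lemma entry_le_specnorm (A : 'M[R]_d) a e : `|A a e| <= specnorm A.
Proof.
have Ab i j : `|A i j| <= `|A|.
  by rewrite [leRHS]/Num.norm/= mx_normrE; apply: (bigmax_sup (i, j)).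
apply: (@le_trans _ _ (enorm (delta_mx 0 e *m A^T))).
  by have := coord_le_enorm (delta_mx 0 e *m A^T) a; rewrite -rowE !mxE.
apply: ub_le_sup; last by exists (delta_mx 0 e) => //=; rewrite enorm_delta.
(* A supremum dominates its set only if the set is bounded above; a crude bound by the entries of
   [A] shows this. *)
set c := d%:R * (1 * `|A|).
exists (Num.sqrt (d%:R * (c * c))) => _ [xi /= xi1 <-].
have c0 : 0 <= c by rewrite !mulr_ge0.
have yc i : `|(xi *m A^T) 0 i| <= c.
  have -> : (xi *m A^T) 0 i = dotv xi (row i A).
    by rewrite mxE; apply: eq_bigr => j _; rewrite !mxE.
  apply: norm_dotv_le => // j; last by rewrite mxE.
  by apply: le_trans (coord_le_enorm _ _) xi1.
rewrite ler_wsqrtr //; apply: le_trans (ler_norm _) _.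
exact: norm_dotv_le.
Qed.

(** Orthogonal [Q] preserves the norm of [w], which the scaling then normalizes. The inequality also
    covers the default value 0 of [normal]. *)
Lemma enorm_normal_le1 O x : enorm (normal O x) <= 1.
Proof.
rewrite /normal; case: xgetP => [nu _ [j [Q [phi [r [[QQ _ _ _] _ ->]]]]]|_]; last first.
  by rewrite /enorm dotv0l sqrtr0.
set w := downward _ _ _.
have wQ : enorm (w *m Q^T) = enorm w.
  congr Num.sqrt; rewrite !dotvE trmx_mul trmxK mulmxA -(mulmxA w).
  by rewrite (mulmx1C QQ) mulmx1.
rewrite enormZ wQ ger0_norm ?invr_ge0 ?enorm_ge0 //.
by have [->|w0] := eqVneq (enorm w) 0; rewrite ?mulr0 // mulVf.
Qed.

Lemma good_domain_closure O x : good_domain O -> O x \/ bdry O x ->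
  forall i, `|x 0 i| <= 1.
Proof.
move=> [_ Ob] Ox i.
have : closure O x.
  by case: Ox => [Ox|[]] //; exact: subset_closure.
have cC : closed [set y : 'rV[R]_d | `|y 0 i| <= 1].
  apply: (@closed_comp _ _ (fun y : 'rV[R]_d => `|y 0 i|) [set t : R | t <= 1]).
    move=> y _; apply: continuous_comp; last exact: norm_continuous.
    exact: coord_continuous.
  exact: closed_le.
have OC : O `<=` [set y : 'rV[R]_d | `|y 0 i| <= 1].
  by move=> y /Ob/(_ i) yi /=; rewrite ler_norml; lra.
by move=> /(closure_subset OC); rewrite -(closure_id _).1.
Qed.

Definition ridge_bounds (c2 c1 c0 : R) (A : 'M[R]_d) (b : 'rV[R]_d) (c : R) :=
  [/\ forall a e, `|A a e| <= c2, forall a, `|b 0 a| <= c1 & `|c| <= c0].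

(** The sums [L2 + L4] and [L3 + L5] dominate interior and boundary coefficients at once. The
    coefficients are chosen before [F], [k] and [v], so one triple serves a whole row of the feature
    matrix. *)
Lemma opLtilde_ridge O P L1 L2 L3 L4 L5 x : open O ->
  0 < L1 -> 0 < L2 -> 0 < L3 -> 0 < L4 -> 0 < L5 ->
  bounded_coeffs O L1 L2 L3 L4 L5 P -> O x \/ bdry O x ->
  exists A b c, ridge_bounds L1 (L2 + L4) (L3 + L5) A b c /\
    forall F k v, derivative_tower F -> let z := dotv k x + v in
    opLtilde O P (fun y => F 0%N (dotv k y + v)) x =
      ridge_symbol A b c k (F 2%N z) (F 1%N z) (F 0%N z).
Proof.
move=> oO L1p L2p L3p L4p L5p [PO PB] [Ox|Bx].
  have [_ Ax bx cx] := PO x Ox.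
  exists (cA P x), (cb P x), (cc P x); split; last first.
    by move=> F k v dF; rewrite /opLtilde mem_set // opL_ridge.
  split => [a e|a|]; last by lra.
    exact: le_trans (entry_le_specnorm _ _ _) Ax.
  by have := coord_le_enorm (cb P x) a; lra.
have [g1x g2x] := PB x Bx.
exists 0, (cg1 P x *: normal O x), (cg2 P x); split; last first.
  move=> F k v dF; rewrite /opLtilde memNset ?opB_ridge //.
  by case: Bx => _; have /interior_id -> := oO.
split => [a e|a|]; rewrite ?mxE ?normr0 ?(ltW L1p) //; last by lra.
rewrite normrM; apply: (@le_trans _ _ (L4 * 1)); last by lra.
apply: ler_pM => //; apply: le_trans (coord_le_enorm _ _) _.
exact: enorm_normal_le1.
Qed.

End CoefficientBounds.

(** * Upper bound for the smallest singular value *)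

Section SmallestSingularValue.
Variables (R : realType) (d p D : nat) (F : nat -> R -> R).
Variables (k : 'I_p -> 'rV[R]_d) (v : 'I_p -> R) (w : 'rV[R]_p) (B K : R).
Hypotheses (d0 : (0 < d)%N) (dF : derivative_tower F) (D2 : (2 <= D)%N).
Hypotheses (K0 : 0 <= K) (kK : forall j i, `|k j 0 i| <= K).
Hypothesis FB : forall t, `|F D t| <= B.
Hypothesis wP : forall a : {ffun 'I_d -> 'I_D},
  \sum_j w 0 j * (F (\sum_i a i)%N (v j) * \prod_i k j 0 i ^+ a i) = 0.

(** A common bound for derivatives of order [r = 0, 1, 2]: the derivative contributes [(d K)^r] and
    the remainder [(d K)^(D - r) / (D - r)!], whose factorial is smallest at [r = 2]. *)
Let rho := B * (d%:R * K) ^+ D / (D - 2)`!%:R.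

(* The Taylor polynomial of the r-th derivative at v_j contributes nothing by
   the choice of w, so only the remainder of order D - r is left. *)
Lemma annihilated_ridge_sum (r : nat) (y : nat -> 'rV[R]_d) (x : 'rV[R]_d) :
  (r <= 2)%N -> (forall i, `|x 0 i| <= 1) ->
  (forall l j, (l < r)%N -> `|dotv (k j) (y l)| <= K) ->
  `|\sum_j w 0 j * (\prod_(l < r) dotv (k j) (y l) * F r (dotv (k j) x + v j))|
    <= (\sum_j `|w 0 j|) * rho.
Proof.
move=> r2 x1 yK.
pose T j := \sum_(q < D - r) F (r + q)%N (v j) * (dotv (k j) x ^+ q / q`!%:R).
have poly0 : \sum_j w 0 j * (\prod_(l < r) dotv (k j) (y l) * T j) = 0.
  under eq_bigr do rewrite !mulr_sumr.
  rewrite exchange_big big1 //= => q _.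
  (* The [r] directions followed by copies of [x]: derivative factors and Taylor powers form one
     product of [r + q < D] linear forms, which [w] annihilates. *)
  pose z (l : nat) := if (l < r)%N then y l else x.
  have rqD : (r + q < D)%N by rewrite -ltn_subRL.
  have := @annihilator_prod_dotv _ _ _ _ k (fun j m => F m (v j)) w wP (r + q)%N z rqD.
  move=> /(congr1 ( *%R q`!%:R^-1)); rewrite mulr0 => pz.
  rewrite -[RHS]pz mulr_sumr; apply: eq_bigr => j _; rewrite big_split_ord /=.
  have -> : \prod_(i < r) dotv (k j) (z i) = \prod_(i < r) dotv (k j) (y i).
    by apply: eq_bigr => i _; rewrite /z ltn_ord.
  have -> : \prod_(i < q) dotv (k j) (z (r + i)%N) = dotv (k j) x ^+ q.
    rewrite -[X in _ ^+ X](card_ord q) -prodr_const; apply: eq_bigr => i _.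
    by rewrite /z ltnNge leq_addr.
  by ring.
have dK j : `|dotv (k j) x| <= d%:R * K by rewrite -[K]mulr1; apply: norm_dotv_le.
have D0 : (d%:R * K) * (d%:R * K) >= 0 by rewrite !mulr_ge0.
have B0 : 0 <= B := le_trans (normr_ge0 _) (FB 0).
rewrite -[X in `|X|]subr0 -[X in `|_ - X|]poly0 -sumrB.
apply: le_trans (ler_norm_sum _ _ _) _; rewrite mulr_suml; apply: ler_sum => j _.
rewrite -!mulrBr !normrM ler_wpM2l // normr_prod.
have rD : (r <= D)%N := leq_trans r2 D2.
have F' t : `|F (r + (D - r))%N t| <= B by rewrite subnKC.
apply: (@le_trans _ _ ((d%:R * K) ^+ r * (B * ((d%:R * K) ^+ (D - r) / (D - r)`!%:R)))).
  apply: ler_pM => //; first exact: prodr_ge0.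
    apply: (@le_trans _ _ (\prod_(l < r) (d%:R * K))); last first.
      by rewrite prodr_const card_ord.
    apply: ler_prod => l _; rewrite normr_ge0 /=; apply: le_trans (yK _ _ _) _ => //.
    by rewrite ler_peMl // ler1n.
  apply: (le_trans (taylor_bound (v j) (dotv (k j) x) dF F')); rewrite ler_wpM2l //.
  by rewrite ler_wpM2r ?invr_ge0 // lerXn2r ?nnegrE ?mulr_ge0.
have eD : (d%:R * K) ^+ D = (d%:R * K) ^+ r * (d%:R * K) ^+ (D - r).
  by rewrite -exprD subnKC.
rewrite /rho eD.
rewrite [leLHS](_ : _ = B * ((d%:R * K) ^+ r * (d%:R * K) ^+ (D - r)) / (D - r)`!%:R);
  last by ring.
rewrite ler_wpM2l ?mulr_ge0 ?exprn_ge0 ?mulr_ge0 //.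
rewrite lef_pV2 ?posrE ?ltr0n ?fact_gt0 // ler_nat.
by apply: leq_fact; rewrite leq_sub2l.
Qed.

(** After exchanging sums, each coefficient multiplies a sum bounded by [annihilated_ridge_sum]
    along basis vectors, with [r = 2, 1, 0]; the factors [d^2], [d], [1] count the coefficients. *)
Lemma ridge_symbol_sum (c2 c1 c0 : R) A b c (x : 'rV[R]_d) :
  ridge_bounds c2 c1 c0 A b c -> (forall i, `|x 0 i| <= 1) ->
  `|\sum_j w 0 j * (let z := dotv (k j) x + v j in
      ridge_symbol A b c (k j) (F 2%N z) (F 1%N z) (F 0%N z))| <=
  (\sum_j `|w 0 j|) * ((d%:R ^+ 2 * c2 + d%:R * c1 + c0) * rho).
Proof.
move=> [Ac bc cc] x1; set z := fun j => dotv (k j) x + v j.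
set W := \sum_j `|w 0 j|.
pose e (i : 'I_d) := delta_mx 0 i : 'rV[R]_d.
have B2 a a' : `|\sum_j w 0 j * (k j 0 a * k j 0 a' * F 2%N (z j))| <= W * rho.
  have := @annihilated_ridge_sum 2 (fun l => if l == 0%N then e a else e a') x isT x1.
  under eq_bigr do rewrite 2!big_ord_recl big_ord0 mulr1 /= !dotv_delta.
  by apply=> l j _; case: ifP => _; rewrite dotv_delta.
have B1 a : `|\sum_j w 0 j * (k j 0 a * F 1%N (z j))| <= W * rho.
  have := @annihilated_ridge_sum 1 (fun=> e a) x isT x1.
  under eq_bigr do rewrite big_ord_recl big_ord0 mulr1 /= !dotv_delta.
  by apply=> l j _; rewrite dotv_delta.
have B0 : `|\sum_j w 0 j * F 0%N (z j)| <= W * rho.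
  have := @annihilated_ridge_sum 0 (fun=> x) x isT x1.
  under eq_bigr do rewrite big_ord0 mul1r.
  by apply.
have Wr : 0 <= W * rho := le_trans (normr_ge0 _) B0.
have -> : \sum_j w 0 j * ridge_symbol A b c (k j) (F 2%N (z j)) (F 1%N (z j)) (F 0%N (z j)) =
    \sum_a \sum_a' A a a' * (\sum_j w 0 j * (k j 0 a * k j 0 a' * F 2%N (z j))) +
    \sum_a b 0 a * (\sum_j w 0 j * (k j 0 a * F 1%N (z j))) +
    c * (\sum_j w 0 j * F 0%N (z j)).
  rewrite /ridge_symbol; under eq_bigr do rewrite !mulrDr.
  rewrite !big_split /=; congr (_ + _ + _).
  - under eq_bigr do rewrite mulr_sumr.
    rewrite exchange_big /=; apply: eq_bigr => a _.
    under eq_bigr do rewrite mulr_sumr.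
    rewrite exchange_big /=; apply: eq_bigr => a' _.
    by rewrite mulr_sumr; apply: eq_bigr => j _; rewrite mulrCA.
  - under eq_bigr do rewrite mulr_sumr.
    rewrite exchange_big /=; apply: eq_bigr => a _.
    by rewrite mulr_sumr; apply: eq_bigr => j _; rewrite mulrCA.
  - by rewrite mulr_sumr; apply: eq_bigr => j _; rewrite mulrCA.
apply: (@le_trans _ _ (d%:R ^+ 2 * (c2 * (W * rho)) + d%:R * (c1 * (W * rho)) +
    c0 * (W * rho))); last by rewrite le_eqVlt; apply/orP; left; apply/eqP; ring.
apply: le_trans (ler_normD _ _) _; apply: lerD; last by rewrite normrM ler_pM.
apply: le_trans (ler_normD _ _) _; apply: lerD; last first.
  apply: le_trans (ler_norm_sum _ _ _) _; rewrite mulr_natl -sumr_ord.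
  by apply: ler_sum => a _; rewrite normrM ler_pM.
apply: le_trans (ler_norm_sum _ _ _) _; rewrite expr2 -mulrA mulr_natl -sumr_ord.
apply: ler_sum => a _.
apply: le_trans (ler_norm_sum _ _ _) _; rewrite mulr_natl -sumr_ord.
by apply: ler_sum => a' _; rewrite normrM ler_pM.
Qed.

End SmallestSingularValue.

(** The annihilator is the test vector for [sing_last_le_err]; [D ^ d < p] is what makes it
    exist. *)
Lemma sing_last_ridge (R : realType) (d n1 n2 p D : nat) (O : set 'rV[R]_d)
    (P : coeffs R d) (L1 L2 L3 L4 L5 : R) (F : nat -> R -> R)
    (x : 'I_(n1 + n2) -> 'rV[R]_d) (k : 'I_p -> 'rV[R]_d) (v : 'I_p -> R)
    (psi : 'I_p -> 'rV[R]_d -> R) (s : seq R) (B K : R) :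
  (0 < d)%N -> good_domain O ->
  0 < L1 -> 0 < L2 -> 0 < L3 -> 0 < L4 -> 0 < L5 ->
  bounded_coeffs O L1 L2 L3 L4 L5 P -> collocation O x ->
  derivative_tower F -> (forall j, psi j = fun y => F 0%N (dotv (k j) y + v j)) ->
  (2 <= D)%N -> (D ^ d < p)%N -> 0 <= K -> (forall j i, `|k j 0 i| <= K) ->
  (forall t, `|F D t| <= B) -> singular_values (feature_mx O P psi x) s ->
  sing s p <= Num.sqrt ((n1 + n2)%:R * p%:R) *
    ((d%:R ^+ 2 * L1 + d%:R * (L2 + L4) + (L3 + L5)) *
     (B * (d%:R * K) ^+ D / (D - 2)`!%:R)).
Proof.
move=> d0 gO L1p L2p L3p L4p L5p bP [xO xB] dF psiE D2 Dp K0 kK FB sP.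
have cT : (#|{ffun 'I_d -> 'I_D}| < p)%N by rewrite card_ffun !card_ord.
have [w w0 wP] := exists_annihilator
  (fun j (a : {ffun 'I_d -> 'I_D}) => F (\sum_i a i)%N (v j) * \prod_i k j 0 i ^+ a i) cT.
have p0 : (0 < p)%N by apply: leq_ltn_trans Dp.
have B0 : 0 <= B := le_trans (normr_ge0 _) (FB 0).
apply: (sing_last_le_err sP p0 w0).
  rewrite !mulr_ge0 ?invr_ge0 ?exprn_ge0 ?mulr_ge0 //.
  by rewrite !addr_ge0 ?mulr_ge0 ?addr_ge0 ?exprn_ge0 // ltW.
move=> i.
have Oi : O (x i) \/ bdry O (x i).
  rewrite -(splitK i); case: (fintype.split i) => i' /=; first by left.
  by right; case: (xB i').
have [[oO _ _ _ _] _] := gO.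
have [A [b [c [Abc LE]]]] := opLtilde_ridge oO L1p L2p L3p L4p L5p bP Oi.
have -> : (w *m (feature_mx O P psi x)^T) 0 i = \sum_j w 0 j *
   (let z := dotv (k j) (x i) + v j in
      ridge_symbol A b c (k j) (F 2%N z) (F 1%N z) (F 0%N z)).
  by rewrite mxE; apply: eq_bigr => j _; rewrite !mxE psiE LE.
apply: ridge_symbol_sum => //; exact: good_domain_closure gO Oi.
Qed.

(** The product form includes the case where the last singular value is 0 and the ratio is
    infinite. *)
Lemma sing_ratio_ge (R : realType) (s : seq R) m (X : R) :
  0 <= sing s m -> X * sing s m <= sing s 1 -> (X%:E <= sing_ratio s m)%E.
Proof.
move=> s0 Xs; rewrite /sing_ratio; case: eqP => [_|/eqP sn0]; first exact: leey.
by rewrite lee_fin ler_pdivlMr // lt_neqAle eq_sym sn0.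
Qed.

Lemma ridge_symbolE (R : realType) d (A : 'M[R]_d) b c (k : 'rV[R]_d) f2 f1 f0 :
  ridge_symbol A b c k f2 f1 f0 = qform A k * f2 + dotv b k * f1 + c * f0.
Proof.
rewrite /ridge_symbol /qform /dotv !mulr_suml; congr (_ + _ + _).
  apply: eq_bigr => a _; rewrite mulr_suml; apply: eq_bigr => e _.
  ring.
by apply: eq_bigr => a _; rewrite mulrA.
Qed.

Lemma exists_max_norm (R : realType) d p (k : 'I_p -> 'rV[R]_d) : (0 < p)%N ->
  exists j0, forall j i, `|k j 0 i| <= `|k j0|.
Proof.
case: p k => // p k _.
have [j0 _ j0P] := @arg_maxP _ _ _ ord0 xpredT (fun j => `|k j|) isT.
by exists j0 => j i; apply: le_trans (coord_le_norm _ _) (j0P j isT).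
Qed.

(** * Fourier features: lower bound for the largest singular value *)

Section Fourier.
Variable R : realType.

(** Each derivative of cosine is a quarter-turn shift. Sine features use the same tower with the
    phase [- (pi / 2)]. *)
Definition cos_tower (m : nat) (t : R) := cos (t + m%:R * (pi / 2)).

Lemma cos_tower_derivative : derivative_tower cos_tower.
Proof.
move=> m t; rewrite /cos_tower.
have di : is_derive t (1 : R) (fun t : R => t + m%:R * (pi / 2)) 1.
  by apply: is_derive_eq; rewrite addr0.
have dc := @is_derive1_comp _ (@cos R) _ t _ _ (is_derive_cos _) di.
apply: (is_derive_eq dc); rewrite mulr1 -cosDpihalf -natr1; congr cos; ring.
Qed.

Lemma cos_tower0 t : cos_tower 0 t = cos t.
Proof. by rewrite /cos_tower mul0r addr0. Qed.

Lemma cos_tower1 t : cos_tower 1 t = - sin t.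
Proof. by rewrite /cos_tower mul1r cosDpihalf. Qed.

Lemma cos_tower2 t : cos_tower 2 t = - cos t.
Proof.
by rewrite /cos_tower (_ : 2%:R * (pi / 2) = pi) ?cosDpi //; field.
Qed.

Variables (d N : nat) (k : 'I_N -> 'rV[R]_d).

Definition fourier_freq (j : 'I_(N + N)) :=
  match fintype.split j with inl i => k i | inr i => k i end.

Definition fourier_phase (j : 'I_(N + N)) : R :=
  match fintype.split j with inl _ => 0 | inr _ => - (pi / 2) end.

Lemma fourier_featuresE j :
  fourier_features k j =
  fun y => cos_tower 0 (dotv (fourier_freq j) y + fourier_phase j).
Proof.
apply/funext => y; rewrite cos_tower0 /fourier_features /fourier_freq /fourier_phase.
by case: fintype.split => i; rewrite ?addr0 // cosBpihalf.
Qed.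

Variables (O : set 'rV[R]_d) (P : coeffs R d) (alow : R).
Variables (n1 n2 : nat) (x : 'I_(n1 + n2) -> 'rV[R]_d) (s : seq R).
Hypotheses (oO : open O) (a0 : 0 < alow) (eP : elliptic O P alow).
Hypothesis xC : collocation O x.
Hypothesis sP : singular_values (feature_mx O P (fourier_features k) x) s.

(** Adding the squared cosine and sine columns of one frequency removes the phase, by
    [cos^2 + sin^2 = 1]. An interior row leaves [(c - q)^2 + b^2], and since [- q] and [c] are both
    nonnegative this is at least [q^2 + c^2]; a boundary row leaves at least [g2^2]. The factor 2
    counts the columns. *)
Lemma sing_first_fourier (j : 'I_N) :
  n1%:R * (alow * `|k j| ^+ 2) ^+ 2 + \sum_(i < n1) cc P (x (lshift n2 i)) ^+ 2
    + \sum_(i < n2) cg2 P (x (rshift n1 i)) ^+ 2 <= 2 * sing s 1 ^+ 2.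
Proof.
have N0 : (0 < N + N)%N by rewrite addn_gt0 (leq_ltn_trans _ (ltn_ord j)).
have colc := sing_first_col sP N0 (lshift N j).
have cols := sing_first_col sP N0 (rshift N j).
rewrite [leRHS](_ : _ = sing s 1 ^+ 2 + sing s 1 ^+ 2); last by ring.
apply: le_trans (lerD colc cols).
rewrite -big_split /= big_split_ord /=; apply: lerD.
  rewrite mulr_natl -sumr_ord -big_split; apply: ler_sum => i _ /=.
  have Oi := xC.1 i; have [ek ck] := eP Oi.
  rewrite !mxE !fourier_featuresE /opLtilde mem_set // !(opL_ridge _ _ _ _ cos_tower_derivative).
  rewrite /fourier_freq /fourier_phase (unsplitK (inl j)) (unsplitK (inr j)) /=.
  rewrite !ridge_symbolE addr0 !(cos_tower0, cos_tower1, cos_tower2) sinBpihalf cosBpihalf.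
  set z := dotv (k j) _; set c := cc P _ in ck *; set q := qform _ _; set b := dotv _ _.
  have aq : alow * `|k j| ^+ 2 <= - q.
    apply: le_trans (ek (k j)); rewrite ler_pM2l // lerXn2r ?nnegrE ?enorm_ge0 //.
    exact: norm_le_enorm.
  set X := alow * _ in aq *; have X0 : 0 <= X by rewrite mulr_ge0 ?exprn_ge0 // ltW.
  have cs := cos2Dsin2 z.
  rewrite [leRHS](_ : _ = ((c - q) ^+ 2 + b ^+ 2) * (cos z ^+ 2 + sin z ^+ 2)); last by ring.
  by rewrite cs mulr1; nra.
apply: ler_sum => i _; have [Bi _] := xC.2 i.
have nO : ~ O (x (rshift n1 i)) by case: Bi => _; have /interior_id -> := oO.
rewrite !mxE !fourier_featuresE /opLtilde memNset // !(opB_ridge _ _ _ _ _ cos_tower_derivative).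
rewrite /fourier_freq /fourier_phase (unsplitK (inl j)) (unsplitK (inr j)) /=.
rewrite !ridge_symbolE addr0 !(cos_tower0, cos_tower1, cos_tower2) sinBpihalf cosBpihalf.
have -> : qform (0 : 'M[R]_d) (k j) = 0.
  by apply: big1 => a _; apply: big1 => e _; rewrite mxE mulr0 mul0r.
set z := dotv (k j) _; set c := cg2 P _; set b := dotv _ _.
have cs := cos2Dsin2 z.
rewrite [leRHS](_ : _ = (c ^+ 2 + b ^+ 2) * (cos z ^+ 2 + sin z ^+ 2)); last by ring.
by rewrite cs mulr1 lerDl sqr_ge0.
Qed.

End Fourier.

(** * Factorial growth and the choice of the expansion order *)

Lemma exp_le_fact p i : (p ^ i <= (p + i)`!)%N.
Proof.
elim: i => [|i IHi]; first by rewrite expn0 fact_gt0.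
by rewrite addnS factS expnS leq_mul // leqW // leq_addr.
Qed.

(** The factorial is at least [p ^ ((d + 2) p - 2)]. Of this exponent, [p] pays for the power of
    [Y], [d p] is kept, and the remaining [p - 2] is nonnegative. *)
Lemma fact_superexponential d p Y : (1 < p)%N -> (Y ^ (d + 3) <= p)%N ->
  (Y ^ ((d + 3) * p) * p ^ (d * p) <= ((d + 3) * p - 2)`!)%N.
Proof.
move=> p1 Yp; set m := ((d + 2) * p - 2)%N.
have -> : ((d + 3) * p - 2 = p + m)%N.
  have : (2 <= (d + 2) * p)%N by rewrite (leq_trans p1) // leq_pmull // addn2.
  have -> : ((d + 3) * p = p + (d + 2) * p)%N by rewrite -mulSn addnS.
  by move=> ?; rewrite /m addnBA.
apply: leq_trans (exp_le_fact p m).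
apply: (@leq_trans (p ^ (p + d * p))); first by rewrite expnD leq_mul // expnM leq_exp2r ?(ltnW p1).
rewrite leq_exp2l // /m.
have -> : ((d + 2) * p = p + d * p + p)%N by rewrite mulnDl mul2n -addnn addnCA addnA.
by rewrite -addnBA // leq_addr.
Qed.

Section Degree.
Variables (R : realType) (d : nat).
Hypothesis d0 : (0 < d)%N.
Implicit Types M : R.

Lemma powR_invK M : 0 <= M -> (M `^ d%:R^-1) ^+ d = M.
Proof.
move=> M0; rewrite -powR_mulrn ?powR_ge0 // -powRrM mulVf ?powRr1 //.
by rewrite pnatr_eq0 -lt0n.
Qed.

Lemma powR_inv_ge M (c : R) : 0 <= c -> c ^+ d <= M -> c <= M `^ d%:R^-1.
Proof.
move=> c0 cM; have M0 : 0 <= M := le_trans (exprn_ge0 _ c0) cM.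
by rewrite -(@ler_pXn2r _ d) ?nnegrE ?powR_ge0 // powR_invK.
Qed.

Lemma exists_degree M : 1 <= M ->
  exists p : nat, M `^ d%:R^-1 <= p%:R <= 2 * M `^ d%:R^-1.
Proof.
move=> M1; have y1 : 1 <= M `^ d%:R^-1 by apply: powR_inv_ge; rewrite ?expr1n.
set y := M `^ _ in y1 *; exists (Num.truncn y).+1.
have := truncnS_gt y; have := truncn_le y.
by rewrite (le_trans ler01 y1) -natr1 => ty /ltW ->; lra.
Qed.

(** The left side is at most [(2 c)^d M], and the threshold on [M] says exactly that
    [(2 c)^d <= ln M]. *)
Lemma degree_count M (c p : nat) : expR ((2 * c%:R) ^+ d) <= M ->
  p%:R <= 2 * M `^ d%:R^-1 -> ((c * p) ^ d)%:R <= 3 * M * ln (15 * M).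
Proof.
move=> cM py; have M0 : 0 < M := lt_le_trans (expR_gt0 _) cM.
have M1 : 1 <= M.
  by apply: le_trans cM; rewrite -expR0 ler_expR exprn_ge0 // mulr_ge0.
have lnM : (2 * c%:R) ^+ d <= ln M by rewrite -ler_expR lnK.
have lnM15 : ln M <= ln (15 * M) by rewrite ler_ln ?posrE; lra.
have l0 : 0 <= ln (15 * M) by apply: ln_ge0; lra.
apply: (@le_trans _ _ (M * ln (15 * M))); last by nra.
apply: (@le_trans _ _ (M * (2 * c%:R) ^+ d)); last first.
  by rewrite ler_wpM2l ?(ltW M0) // (le_trans lnM).
rewrite natrX natrM -[M in leRHS]powR_invK ?(ltW M0) // -exprMn.
rewrite lerXn2r ?nnegrE ?mulr_ge0 ?powR_ge0 //.
rewrite [leRHS](_ : _ = c%:R * (2 * M `^ d%:R^-1)); last by ring.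
by rewrite ler_wpM2l.
Qed.

Lemma aF_le1 : aF R d <= 1.
Proof.
have e1 : 1 <= expR (1 : R) by rewrite -expR0 ler_expR.
rewrite /aF ler_pdivrMr ?mulr_gt0 ?expR_gt0 // mul1r.
have : 2 `^ (1 - d%:R^-1) <= 2 :> R.
  rewrite -[leRHS]powRr1 // ler_powR ?ler1n // lerBlDr lerDl invr_ge0 //.
lra.
Qed.

(** The order is [D = (d + 3) p] with [p] comparable to [M^(1/d)]. In [fact_superexponential],
    [p ^ (d p) = exp (d p ln p)] dominates the exponential, since [ln M = d ln (M^(1/d))]. *)
Lemma fourier_degree (Y : nat) : exists M0 : R, forall M : R, M0 <= M ->
  exists D, [/\ (2 <= D)%N, (D ^ d)%:R <= 3 * M * ln (15 * M) &
    Y%:R ^+ D * expR (aF R d * M `^ d%:R^-1 * ln M) <= (D - 2)`!%:R].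
Proof.
(* The first term serves [degree_count] with [c = d + 3]; the second forces
   [p >= Y ^ (d + 3) + 2]. *)
exists (expR ((2 * (d + 3)%:R) ^+ d) + (Y ^ (d + 3) + 2)%:R ^+ d) => M MM.
have y2 : (Y ^ (d + 3) + 2)%:R <= M `^ d%:R^-1.
  apply: powR_inv_ge => //; apply: le_trans MM.
  by rewrite lerDr expR_ge0.
have eM : expR ((2 * (d + 3)%:R) ^+ d) <= M.
  by apply: le_trans MM; rewrite lerDl exprn_ge0.
have M1 : 1 <= M.
  by apply: le_trans eM; rewrite -expR0 ler_expR exprn_ge0 // mulr_ge0.
have [p /andP[yp py]] := exists_degree M1.
have Yp : (Y ^ (d + 3) + 2 <= p)%N by rewrite -(ler_nat R) (le_trans y2).
have p2 : (1 < p)%N := leq_trans (leq_addl _ _) Yp.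
exists ((d + 3) * p)%N; split.
- by rewrite (leq_trans p2) // leq_pmull // addn3.
- exact: degree_count.
apply: (@le_trans _ _ (Y ^ ((d + 3) * p) * p ^ (d * p))%:R); last first.
  by rewrite ler_nat fact_superexponential // (leq_trans _ Yp) // leq_addr.
rewrite natrM !natrX ler_wpM2l ?exprn_ge0 //.
set y := M `^ _ in y2 yp py *.
have y1 : 1 <= y by apply: le_trans y2; rewrite ler1n addn2.
have y0 : 0 < y by lra.
have p0 : 0 < p%:R :> R by lra.
have -> : p%:R ^+ (d * p) = expR ((d * p)%:R * ln p%:R) :> R.
  by rewrite expRM_natl lnK.
have lM : ln M = d%:R * ln y by rewrite /y ln_powR mulVKf // pnatr_eq0 -lt0n.
have ly : 0 <= ln y by exact: ln_ge0.
have lyp : ln y <= ln p%:R by rewrite ler_ln ?posrE.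
rewrite ler_expR lM natrM -mulrA -[leRHS]mulrA.
apply: (@le_trans _ _ (1 * (y * (d%:R * ln y)))).
  by rewrite ler_wpM2r ?aF_le1 // !mulr_ge0 // ltW.
rewrite mul1r mulrCA ler_wpM2l //.
by apply: ler_pM => //; exact: ltW.
Qed.

End Degree.

(** * Fourier features: the ratio of singular values *)

Lemma sqrt_nat_double (R : realType) (n N : nat) :
  Num.sqrt (n%:R * (N + N)%:R) <= 2 * Num.sqrt (n%:R * N%:R) :> R.
Proof.
rewrite -ler_sqr ?nnegrE ?mulr_ge0 ?sqrtr_ge0 // exprMn !sqr_sqrtr ?mulr_ge0 //.
have : 0 <= n%:R * N%:R :> R by rewrite mulr_ge0.
rewrite natrD; nra.
Qed.

Lemma lt_natB1 (R : realType) (m n : nat) (z : R) :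
  m%:R <= z -> z <= n%:R - 1 -> (m < n)%N.
Proof. by move=> mz zn; rewrite -(ltr_nat R); lra. Qed.

Lemma sing_ratio_fourier (R : realType) (d : nat) (S : R) : (0 < d)%N -> 0 < S ->
  exists M0 : R, forall (O : set 'rV[R]_d) (L1 L2 L3 L4 L5 : R),
    good_domain O ->
    0 < L1 -> 0 < L2 -> 0 < L3 -> 0 < L4 -> 0 < L5 ->
    exists2 q : R, 0 < q &
      forall (P : coeffs R d) (alow : R) (n1 n2 N : nat)
             (x : 'I_(n1 + n2) -> 'rV[R]_d) (k : 'I_N -> 'rV[R]_d)
             (s : seq R) (M : R),
        bounded_coeffs O L1 L2 L3 L4 L5 P ->
        0 < alow -> elliptic O P alow ->
        (0 < n1)%N -> (0 < n2)%N -> (N + N < n1 + n2)%N ->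
        collocation O x ->
        0 < M -> M0 <= M -> 3 * M * ln (15 * M) <= (N + N)%:R - 1 ->
        (forall j, in_cube S (k j)) ->
        singular_values (feature_mx O P (fourier_features k) x) s ->
        let C := Num.sqrt (n1%:R^-1 * \sum_(i < n1) cc P (x (lshift n2 i)) ^+ 2) in
        let G := Num.sqrt (n2%:R^-1 * \sum_(i < n2) cg2 P (x (rshift n1 i)) ^+ 2) in
        ((q * ((Num.sqrt n1%:R * (alow + C) + Num.sqrt n2%:R * G)
                 / Num.sqrt ((n1 + n2)%:R * N%:R))
            * expR (aF R d * M `^ d%:R^-1 * ln M))%:E
         <= sing_ratio s (N + N))%E.
Proof.
(* An integer bound for [d S], hence for [d K], as the factorial estimate is stated over the
   naturals. *)
move=> d0 S0; set Y := (Num.truncn (d%:R * S)).+1.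
have dSY : d%:R * S <= Y%:R by apply: ltW; exact: truncnS_gt.
have [M0 M0P] := fourier_degree R d0 Y.
exists M0 => O L1 L2 L3 L4 L5 gO L1p L2p L3p L4p L5p.
set CL := d%:R ^+ 2 * L1 + d%:R * (L2 + L4) + (L3 + L5).
have CL0 : 0 < CL.
  by rewrite /CL ltr_wpDl ?addr_gt0 // addr_ge0 ?mulr_ge0 ?addr_ge0 ?exprn_ge0 // ltW.
set T := CL * d%:R ^+ 2 * (1 + S ^+ 2).
have T0 : 0 < T by rewrite !mulr_gt0 ?exprn_gt0 ?ltr0n // ltr_wpDr ?sqr_ge0.
(* In [6], a 2 comes from [sqrt_nat_double] and a 3 from [HK]. In [T], [d^2] comes from the two
   powers of [d K] kept in [KD], and [1 + S^2] from [HS]. *)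
exists (6 * T)^-1; first by rewrite invr_gt0 mulr_gt0.
move=> P alow n1 n2 N x k s M bP a0 eP n10 n20 _ xC Mp MM NM kS sP; cbv zeta.
set C := Num.sqrt (n1%:R^-1 * _); set G := Num.sqrt (n2%:R^-1 * _).
have [D [D2 DM DY]] := M0P M MM.
set E := expR _ in DY *.
have Dp := lt_natB1 DM NM.
have NN0 : (0 < N + N)%N := leq_ltn_trans (leq0n _) Dp.
have N0 : (0 < N)%N by move: NN0; rewrite addnn double_gt0.
have [j0 j0P] := exists_max_norm k N0; set K := `|k j0| in j0P.
have KS : K <= S.
  rewrite /K [leLHS]/Num.norm/= mx_normrE; apply/bigmax_leP; split; first exact: ltW.
  by case=> a b _ /=; rewrite ord1 ler_norml; exact: kS.
have K0 : 0 <= K by exact: normr_ge0.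
have [[oO _ _ _ _] _] := gO.
apply: sing_ratio_ge; first exact: (sing_ge0 sP).
have s1 : 0 <= sing s 1 := sing_ge0 sP 1.
have := sing_first_fourier oO a0 eP xC sP j0; rewrite -/K => s1P.
have kF j i : `|fourier_freq k j 0 i| <= K.
  by rewrite /fourier_freq; case: fintype.split.
have B1 t : `|cos_tower D t| <= 1 :> R by exact: cos_max.
have := sing_last_ridge d0 gO L1p L2p L3p L4p L5p bP xC (@cos_tower_derivative R)
  (fourier_featuresE k) D2 Dp K0 kF B1 sP.
rewrite -/CL mul1r => s2P.
set Q := Num.sqrt ((n1 + n2)%:R * N%:R).
have Q0 : 0 < Q by rewrite sqrtr_gt0 mulr_gt0 // ltr0n // addn_gt0 n10.
set H := _ + _ * G.
have sq (n : nat) (z : R) : (0 < n)%N -> 0 <= z -> n%:R * Num.sqrt (n%:R^-1 * z) ^+ 2 = z.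
  move=> n0 z0; rewrite sqr_sqrtr ?mulr_ge0 ?invr_ge0 // mulVKf //.
  by rewrite pnatr_eq0 -lt0n.
have C0 : 0 <= C := sqrtr_ge0 _; have G0 : 0 <= G := sqrtr_ge0 _.
have C2 := sq _ _ n10 (sumr_ge0 _ (fun i _ => sqr_ge0 (cc P (x (lshift n2 i))))).
have G2 := sq _ _ n20 (sumr_ge0 _ (fun i _ => sqr_ge0 (cg2 P (x (rshift n1 i))))).
rewrite -C2 -G2 -/C -/G in s1P.
set u1 := Num.sqrt n1%:R in H *; set u2 := Num.sqrt n2%:R in H *.
have u10 : 0 <= u1 by exact: sqrtr_ge0.
have u20 : 0 <= u2 by exact: sqrtr_ge0.
have u1E : n1%:R = u1 ^+ 2 by rewrite sqr_sqrtr.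
have u2E : n2%:R = u2 ^+ 2 by rewrite sqr_sqrtr.
rewrite u1E u2E in s1P.
(* [(a + b + c)^2 <= 3 (a^2 + b^2 + c^2) <= 6 sing^2 <= 9 sing^2]. *)
have HK : u1 * (alow * K ^+ 2 + C) + u2 * G <= 3 * sing s 1.
  rewrite -ler_sqr ?nnegrE ?addr_ge0 ?mulr_ge0 ?addr_ge0 ?mulr_ge0 ?sqr_ge0 ?(ltW a0) //.
  set a := u1 * (alow * K ^+ 2); set b := u1 * C; set c := u2 * G.
  have e : a ^+ 2 + b ^+ 2 + c ^+ 2 <= 2 * sing s 1 ^+ 2.
    by apply: le_trans s1P; rewrite /a /b /c !exprMn.
  rewrite mulrDr -/a -/b.
  have := sqr_ge0 (a - b); have := sqr_ge0 (a - c); have := sqr_ge0 (b - c).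
  have := sqr_ge0 (sing s 1); nra.
(* The [alow] term already carries [K^2]; for the [C] and [G] terms [K^2 <= 1 + S^2] is used. No
   lower bound on [K] enters. *)
have HS : K ^+ 2 * H <= (1 + S ^+ 2) * (3 * sing s 1).
  have K2S : K ^+ 2 <= 1 + S ^+ 2.
    by apply: (@le_trans _ _ (S ^+ 2)); [rewrite lerXn2r ?nnegrE // ltW | rewrite lerDr].
  have S1 : 1 <= 1 + S ^+ 2 by rewrite lerDl sqr_ge0.
  apply: (@le_trans _ _ ((1 + S ^+ 2) * (u1 * (alow * K ^+ 2 + C) + u2 * G))); last first.
    by rewrite ler_wpM2l // (le_trans ler01).
  rewrite /H.
  have t1 : 0 <= u1 * alow * K ^+ 2 by rewrite !mulr_ge0 ?(ltW a0).
  have t2 : 0 <= u1 * C by rewrite mulr_ge0.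
  have t3 : 0 <= u2 * G by rewrite mulr_ge0.
  nra.
have E0 : 0 < E by exact: expR_gt0.
have fD : 0 < (D - 2)`!%:R :> R by rewrite ltr0n fact_gt0.
(* Two powers of [d K] are kept to match [K^2] in [HS]; the other [D - 2] are absorbed by
   [Y ^+ D]. *)
have KD : (d%:R * K) ^+ D / (D - 2)`!%:R <= d%:R ^+ 2 * K ^+ 2 / E.
  rewrite ler_pdivrMr // mulrAC ler_pdivlMr //.
  apply: (@le_trans _ _ (d%:R ^+ 2 * K ^+ 2 * (Y%:R ^+ D * E))); last first.
    by rewrite ler_wpM2l // mulr_ge0 ?sqr_ge0.
  rewrite mulrA ler_wpM2r ?(ltW E0) //.
  rewrite -[in leLHS](subnKC D2) exprD exprMn ler_wpM2l ?mulr_ge0 ?sqr_ge0 //.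
  apply: (@le_trans _ _ (Y%:R ^+ (D - 2))).
    rewrite lerXn2r ?nnegrE ?mulr_ge0 //; apply: le_trans dSY.
    by rewrite ler_wpM2l.
  by rewrite ler_weXn2l ?ler1n // leq_subr.
have s2Q : sing s (N + N) <= 2 * Q * (CL * (d%:R ^+ 2 * K ^+ 2 / E)).
  apply: le_trans s2P _; apply: ler_pM; rewrite ?sqrtr_ge0 //.
  - by rewrite !mulr_ge0 ?invr_ge0 ?exprn_ge0 ?mulr_ge0 // ltW.
  - exact: sqrt_nat_double.
  - by rewrite ler_wpM2l // ltW.
have H0 : 0 <= H.
  by rewrite addr_ge0 ?mulr_ge0 ?addr_ge0 // ltW.
apply: (@le_trans _ _ ((6 * T)^-1 * (H / Q) * E * (2 * Q * (CL * (d%:R ^+ 2 * K ^+ 2 / E))))).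
  have HQ : 0 <= H / Q by rewrite divr_ge0 // ltW.
  have T1 : 0 <= (6 * T)^-1 by rewrite invr_ge0 mulr_ge0 // ltW.
  by rewrite ler_wpM2l // (mulr_ge0 (mulr_ge0 T1 HQ)) // ltW.
rewrite [leLHS](_ : _ = K ^+ 2 * H / (3 * (1 + S ^+ 2))); last first.
  rewrite /T; field.
  rewrite (gt_eqF E0) (gt_eqF Q0) (gt_eqF CL0) pnatr_eq0 -lt0n d0 /=.
  by rewrite gt_eqF // ltr_wpDr ?sqr_ge0.
rewrite ler_pdivrMr ?mulr_gt0 ?ltr_wpDr ?sqr_ge0 //.
by apply: le_trans HS _; rewrite le_eqVlt; apply/orP; left; apply/eqP; ring.
Qed.

(** * Derivatives and elementary bounds of the hyperbolic tangent *)

Section Tanh.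
Variable R : realType.
Implicit Types t : R.

Let expRD_gt0 t : 0 < expR t + expR (- t).
Proof. by rewrite addr_gt0 // expR_gt0. Qed.

Lemma is_derive_tanh t : is_derive t (1 : R) (@tanh R) (1 - tanh t ^+ 2).
Proof.
have dN : is_derive t (1 : R) (fun t : R => expR (- t)) (- expR (- t)).
  have di : is_derive t (1 : R) (fun t : R => - t) (-1) by apply: is_deriveNid.
  have dc := @is_derive1_comp _ (@expR R) (fun t => - t) t _ _ (is_derive_expR _) di.
  by apply: (is_derive_eq dc); rewrite mulrN1.
have dE : is_derive t (1 : R) (@expR R) (expR t) := is_derive_expR t.
have dn := is_deriveB dE dN; have dd := is_deriveD dE dN.
have nz : (@expR R + (fun t => expR (- t))) t != 0 by rewrite gt_eqF //; exact: expRD_gt0.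
have dq := is_deriveM dn (is_deriveV nz dd).
apply: (is_derive_eq dq).
change ((expR t - expR (- t)) * (- (expR t + expR (- t)) ^- 2 * (expR t - expR (- t))) +
  (expR t + expR (- t))^-1 * (expR t - - expR (- t)) = 1 - tanh t ^+ 2).
by rewrite /tanh; field; rewrite gt_eqF.
Qed.

Lemma tanh_sqr_lt1 t : tanh t ^+ 2 < 1.
Proof.
rewrite /tanh expr_div_n ltr_pdivrMr ?exprn_gt0 // mul1r.
by have := expR_gt0 t; have := expR_gt0 (- t); nra.
Qed.

(* The m-th derivative of tanh^i, through (tanh^i)' = i (tanh^(i-1) - tanh^(i+1));
   at i = 0 the junk value i.-1 = 0 is multiplied by 0. *)
Fixpoint tanh_tower (i m : nat) t : R :=
  if m is m'.+1 then i%:R * (tanh_tower i.-1 m' t - tanh_tower i.+1 m' t)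
  else tanh t ^+ i.

Lemma tanh_tower_derivative i : derivative_tower (tanh_tower i).
Proof.
move=> m; elim: m i => [|m IHm] i t.
  have tE : @tanh R ^+ i = tanh_tower i 0 by apply/funext => u; rewrite exprfctE.
  have dt := is_derive_tanh t; have := is_deriveX i dt.
  rewrite tE => dX; apply: (is_derive_eq dX); rewrite /GRing.scale /=.
  by case: i {tE dX} => [|i]; rewrite ?mul0r //= !exprS; ring.
have d1 := IHm i.-1 t; have d2 := IHm i.+1 t.
have dz : is_derive t (1 : R) (tanh_tower i m.+1)
   (i%:R *: (tanh_tower i.-1 m.+1 t - tanh_tower i.+1 m.+1 t)).
  exact: (is_deriveZ i%:R (is_deriveB d1 d2)).
exact: dz.
Qed.

(** Each differentiation multiplies by the index and splits into two towers of index at most [i.+1],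
    giving [2 ^ m] and a rising factorial. *)
Lemma tanh_tower_bound i m t :
  `|tanh_tower i m t| <= (2 ^ m * \prod_(l < m) (i + l))%:R.
Proof.
elim: m i => [|m IHm] i.
  rewrite /= big_ord0 normrX exprn_ile1 // -ler_sqr ?nnegrE // expr1n.
  by rewrite real_normK ?num_real // ltW // tanh_sqr_lt1.
rewrite big_ord_recl addn0 /= normrM normr_nat expnS.
have eS : (\prod_(l < m) (i + bump 0 l) = \prod_(l < m) (i.+1 + l))%N.
  by apply: eq_bigr => l _; rewrite /bump addSnnS.
rewrite eS (_ : 2 * 2 ^ m * (i * \prod_(l < m) (i.+1 + l)) =
   i * (2 * (2 ^ m * \prod_(l < m) (i.+1 + l))))%N; last by rewrite mulnCA -!mulnA.
rewrite natrM ler_wpM2l // mul2n -addnn natrD.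
apply: le_trans (ler_normB _ _) _; apply: lerD; last exact: IHm.
apply: le_trans (IHm _) _; rewrite ler_nat leq_mul2l; apply/orP; right.
by apply: leq_prod => l _; rewrite leq_add2r (leq_trans (leq_pred _)).
Qed.

(** This [m!] cancels the Taylor factorial up to a quadratic factor, so the decay is only geometric
    and calls for small frequencies. *)
Lemma tanh_tower1_bound m t : `|tanh_tower 1 m t| <= 2 ^+ m * m`!%:R.
Proof.
have -> : 2 ^+ m * m`!%:R = (2 ^ m * \prod_(l < m) (1 + l))%:R :> R.
  rewrite natrM natrX; congr (_ * _%:R).
  by elim: m => [|m IHm]; rewrite ?big_ord0 // big_ord_recr -IHm factS mulnC.
exact: tanh_tower_bound.
Qed.

(** For [t >= 0] the numerator is at least [t], by [1 + t <= expR t], and the denominator at most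
    [2 expR Z]; oddness gives the rest. *)
Lemma norm_tanh_ge (Z t : R) : `|t| <= Z -> `|t| / (2 * expR Z) <= `|tanh t|.
Proof.
have pos u : 0 <= u -> u <= Z -> u / (2 * expR Z) <= tanh u.
  move=> u0 uZ; rewrite /tanh.
  have Z0 := expR_gt0 Z; have euZ : expR u <= expR Z by rewrite ler_expR.
  have enu : expR (- u) <= 1 by rewrite -expR0 ler_expR; lra.
  have eu : 1 + u <= expR u := expR_ge1Dx u.
  have eZ : 1 <= expR Z by rewrite -expR0 ler_expR; lra.
  have un : u <= expR u - expR (- u) by lra.
  have iZ : 0 <= (2 * expR Z)^-1 by rewrite invr_ge0 mulr_ge0 // ltW.
  apply: ler_pM => //.
  by rewrite lef_pV2 ?posrE ?expRD_gt0 ?mulr_gt0 //; lra.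
have tN u : tanh (- u) = - tanh u :> R.
  by rewrite /tanh opprK -mulNr opprB; congr (_ / _); exact: addrC.
have [t0|t0] := leP 0 t; first by rewrite ger0_norm // => tZ; exact: le_trans (pos _ _ _) (ler_norm _).
rewrite ltr0_norm // => tZ; rewrite -normrN -tN.
by apply: le_trans (pos _ _ _) (ler_norm _) => //; lra.
Qed.

(** The right side equals [4 / (expR t + expR (- t))^2]. *)
Lemma one_sub_tanh2_ge (Z t : R) : `|t| <= Z -> expR Z ^- 2 <= 1 - tanh t ^+ 2.
Proof.
rewrite ler_norml => /andP[t1 t2].
have e1 : expR t <= expR Z by rewrite ler_expR.
have e2 : expR (- t) <= expR Z by rewrite ler_expR; lra.
have -> : 1 - tanh t ^+ 2 = 4 * (expR t * expR (- t)) / (expR t + expR (- t)) ^+ 2.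
  by rewrite /tanh; field; rewrite gt_eqF.
rewrite -expRD subrr expR0 mulr1.
rewrite ler_pdivlMr ?exprn_gt0 // mulrC ler_pdivrMr ?exprn_gt0 ?expR_gt0 //.
have := expR_gt0 t; have := expR_gt0 (- t); nra.
Qed.

End Tanh.

(** * Tanh features: both extreme singular values and their ratio *)

(** Otherwise the projections of all points on the direction of [k] would lie in an interval of
    length [r0] centred at [- v / |k|], contradicting a width of at least [2 r0]. *)
Lemma exists_wide_point (R : realType) (d n : nat) (x : 'I_n -> 'rV[R]_d)
    (r0 v : R) (k : 'rV[R]_d) : (0 < n)%N -> 0 < r0 -> k != 0 ->
  2 * r0 <= min_width x -> exists i, r0 / 2 * enorm k <= `|dotv k (x i) + v|.
Proof.
move=> n0 r00 k0 wx.
have e0 : 0 < enorm k.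
  rewrite lt_neqAle enorm_ge0 andbT eq_sym sqrtr_eq0 -ltNge.
  by rewrite lt_neqAle eq_sym dotv_eq0 k0 dotv_ge0.
apply: contrapT => /forallNP nk.
set th := (enorm k)^-1 *: k.
have thk i : dotv th (x i) = dotv k (x i) / enorm k by rewrite dotvZl mulrC.
have b i : - (r0 / 2) <= dotv th (x i) + v / enorm k <= r0 / 2.
  rewrite thk -mulrDl -ler_norml normrM normfV (gtr0_norm e0) ler_pdivrMr //.
  by apply: ltW; rewrite ltNge; apply/negP; exact: nk.
have ne : range (fun i => dotv th (x i)) !=set0.
  by exists (dotv th (x (Ordinal n0))), (Ordinal n0).
have : width x th <= r0.
  have s1 : sup (range (fun i => dotv th (x i))) <= r0 / 2 - v / enorm k.
    by apply: ge_sup => // _ [i _ <-]; have := b i; lra.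
  have s2 : - (r0 / 2) - v / enorm k <= inf (range (fun i => dotv th (x i))).
    by apply: lb_le_inf => // _ [i _ <-]; have := b i; lra.
  by rewrite /width; lra.
have : min_width x <= width x th.
  (* The infimum is a lower bound only for a set bounded below: widths are nonnegative, the ranges
     being finite. *)
  apply: ge_inf; last first.
    by exists th => //=; rewrite enormZ ger0_norm ?invr_ge0 ?enorm_ge0 // mulVf // gt_eqF.
  exists 0 => _ [th' _ <-]; rewrite /width subr_ge0.
  have bS i : `|dotv th' (x i)| <= \sum_j `|dotv th' (x j)|.
    by rewrite (bigD1 i) //= lerDl sumr_ge0.
  have in0 : range (fun i => dotv th' (x i)) (dotv th' (x (Ordinal n0))) by exists (Ordinal n0).
  apply: (@le_trans _ _ (dotv th' (x (Ordinal n0)))).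
    apply: ge_inf => //; exists (- \sum_j `|dotv th' (x j)|) => _ [i _ <-].
    by have := bS i; rewrite ler_norml => /andP[].
  apply: ub_le_sup => //; exists (\sum_j `|dotv th' (x j)|) => _ [i _ <-].
  by have := bS i; rewrite ler_norml => /andP[].
lra.
Qed.

Lemma tanh_featuresE (R : realType) d p (k : 'I_p -> 'rV[R]_d) (v : 'I_p -> R) j :
  tanh_features k v j = fun y => tanh_tower 1 0 (dotv (k j) y + v j).
Proof. by apply/funext => y; rewrite /tanh_features /= expr1. Qed.

(* With b = 0, [L (tanh z) = tanh z * (2 (- k^T A k) (1 - tanh^2 z) + c)], where both
   summands are nonnegative; the width hypothesis keeps |z| of order |k| at some x_i. *)
Lemma sing_first_tanh (R : realType) (d n1 n2 p : nat) (S r0 alow : R)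
    (O : set 'rV[R]_d) (P : coeffs R d) (x : 'I_(n1 + n2) -> 'rV[R]_d)
    (k : 'I_p -> 'rV[R]_d) (v : 'I_p -> R) (s : seq R) (j : 'I_p) :
  good_domain O -> 0 < S -> 0 < r0 -> 0 < alow -> elliptic O P alow ->
  (0 < n1)%N -> collocation O x -> in_cube S (k j) -> `|v j| <= d%:R * S ->
  (forall y, O y -> cb P y = 0) ->
  2 * r0 <= min_width (fun i : 'I_n1 => x (lshift n2 i)) ->
  singular_values (feature_mx O P (tanh_features k v) x) s ->
  r0 / 2 * expR (2 * d%:R * S) ^- 3 * alow * `|k j| ^+ 3 <= sing s 1.
Proof.
move=> gO S0 r00 a0 eP n10 [xO _] kS vS b0 wx sP.
have [k0|k0] := eqVneq (k j) 0.
  by rewrite k0 normr0 expr0n mulr0 (sing_ge0 sP).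
have [i] := exists_wide_point (v j) n10 r00 k0 wx.
set z := dotv _ _ + _ => zi.
have Oi := xO i; have [ek c0] := eP _ Oi.
have zZ : `|z| <= 2 * d%:R * S.
  rewrite (_ : 2 * d%:R * S = d%:R * (S * 1) + d%:R * S); last by ring.
  apply: le_trans (ler_normD _ _) _; apply: lerD => //.
  apply: norm_dotv_le; first exact: ltW.
    by move=> a; rewrite ler_norml; exact: kS.
  by apply: (good_domain_closure gO); left.
apply: le_trans (sing_first_entry sP (leq_ltn_trans (leq0n _) (ltn_ord j)) (lshift n2 i) j).
rewrite mxE tanh_featuresE /opLtilde mem_set // (opL_ridge _ _ _ _ (@tanh_tower_derivative R 1)).
rewrite ridge_symbolE b0 // dotv0l -/z /= !expr0 !expr1.
set Z := 2 * d%:R * S in zZ *; set c := cc P _ in c0 *; set q := qform _ _; set y := tanh z.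
set K := `|k j|.
have K0 : 0 <= K := normr_ge0 _.
have KE : K <= enorm (k j) := norm_le_enorm _.
have aq : alow * K ^+ 2 <= - q.
  by apply: le_trans (ek (k j)); rewrite ler_pM2l // lerXn2r ?nnegrE ?enorm_ge0.
have eZ := expR_gt0 Z.
have y1 : r0 / 2 * K / (2 * expR Z) <= `|y|.
  apply: le_trans (norm_tanh_ge zZ); rewrite ler_wpM2r ?invr_ge0 ?mulr_ge0 ?(ltW eZ) //.
  by apply: le_trans zi; rewrite ler_wpM2l // divr_ge0 // ltW.
have y2 : expR Z ^- 2 <= 1 - y ^+ 2 := one_sub_tanh2_ge zZ.
rewrite [X in `|X|](_ : _ = y * (2 * (- q) * (1 - y ^+ 2) + c)); last by ring.
have aK0 : 0 <= alow * K ^+ 2 by rewrite mulr_ge0 ?exprn_ge0 // ltW.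
have e2 : 0 < expR Z ^- 2 by rewrite invr_gt0 exprn_gt0.
have qy : 2 * (alow * K ^+ 2) * expR Z ^- 2 <= 2 * (- q) * (1 - y ^+ 2) + c.
  apply: (@le_trans _ _ (2 * (- q) * (1 - y ^+ 2))); last by rewrite lerDl.
  have aK2 : 0 <= 2 * (alow * K ^+ 2) by rewrite mulr_ge0.
  have aq2 : 2 * (alow * K ^+ 2) <= 2 * (- q) by rewrite ler_wpM2l.
  exact: (ler_pM aK2 (ltW e2) aq2 y2).
rewrite normrM (ger0_norm (le_trans _ qy)); last by rewrite mulr_ge0 ?mulr_ge0 // ltW.
(* [tanh] gives [K expR (- Z)] and its derivative with the quadratic form [K^2 expR (- 2 Z)], hence
   the cubes. *)
apply: le_trans (ler_pM _ _ y1 qy).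
- by rewrite le_eqVlt; apply/orP; left; apply/eqP; field; rewrite gt_eqF.
- by rewrite divr_ge0 ?mulr_ge0 ?divr_ge0 // ltW.
- by rewrite mulr_ge0 ?mulr_ge0 // ltW.
Qed.

(** The factorials leave [D (D - 1) <= 4 ^ D]. Of the [D] factors [2 d K], three are kept to match
    [K^3] in [sing_first_tanh] and the others are bounded by [e]. *)
Lemma sing_last_small_tanh (R : realType) (d n1 n2 N D : nat) (O : set 'rV[R]_d)
    (P : coeffs R d) (L1 L2 L3 L4 L5 : R)
    (x : 'I_(n1 + n2) -> 'rV[R]_d) (k : 'I_(N + N) -> 'rV[R]_d)
    (v : 'I_(N + N) -> R) (s : seq R) (K e : R) :
  (0 < d)%N -> good_domain O ->
  0 < L1 -> 0 < L2 -> 0 < L3 -> 0 < L4 -> 0 < L5 ->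
  bounded_coeffs O L1 L2 L3 L4 L5 P -> collocation O x ->
  (3 <= D)%N -> (D ^ d < N + N)%N -> 0 <= K -> (forall j i, `|k j 0 i| <= K) ->
  0 < e -> 2 * d%:R * K <= e ->
  singular_values (feature_mx O P (tanh_features k v) x) s ->
  sing s (N + N) <= 2 * Num.sqrt ((n1 + n2)%:R * N%:R) *
    ((d%:R ^+ 2 * L1 + d%:R * (L2 + L4) + (L3 + L5)) *
     ((2 * d%:R * K / e) ^+ 3 * (4 * e) ^+ D)).
Proof.
move=> d0 gO L1p L2p L3p L4p L5p bP xC D3 Dp K0 kK e0 Ke sP.
have D2 : (2 <= D)%N := ltnW D3.
have := sing_last_ridge d0 gO L1p L2p L3p L4p L5p bP xC (@tanh_tower_derivative R 1)
  (tanh_featuresE k v) D2 Dp K0 kK (tanh_tower1_bound D) sP.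
set CL := _ + (L3 + L5).
have CL0 : 0 <= CL by rewrite !addr_ge0 ?mulr_ge0 ?addr_ge0 ?exprn_ge0 // ltW.
have dK0 : 0 <= 2 * d%:R * K by rewrite !mulr_ge0.
have f0 : 0 < (D - 2)`!%:R :> R by rewrite ltr0n fact_gt0.
have fD : D`!%:R = D%:R * (D - 1)%:R * (D - 2)`!%:R :> R.
  by rewrite -!natrM; case: D D3 {D2 Dp f0} => [|[|D]] // _; rewrite !factS !subSS !subn0 mulnA.
have D24 : (D * (D - 1) <= 4 ^ D)%N.
  rewrite (_ : 4 = 2 * 2)%N // expnMn leq_mul //; first exact/ltnW/ltn_expl.
  by apply: leq_trans (leq_subr _ _) _; exact/ltnW/ltn_expl.
move=> sb; apply: le_trans sb _; apply: ler_pM; rewrite ?sqrtr_ge0 //.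
- by rewrite !mulr_ge0 ?invr_ge0 ?exprn_ge0 ?mulr_ge0 // ltW.
- exact: sqrt_nat_double.
rewrite ler_wpM2l //.
rewrite [leLHS](_ : _ = (D * (D - 1))%:R * (2 * d%:R * K) ^+ D); last first.
  by rewrite fD natrM !exprMn; field; rewrite gt_eqF.
rewrite [(4 * e) ^+ D]exprMn mulrCA; apply: ler_pM => //; first exact: exprn_ge0.
  by rewrite -natrX ler_nat.
rewrite -{1 2}(subnKC D3) !exprD mulrA -exprMn divfK ?gt_eqF //.
by rewrite ler_wpM2l ?exprn_ge0 // lerXn2r ?nnegrE // ltW.
Qed.

Lemma sing_ratio_tanh (R : realType) (d : nat) (S aT : R) : (0 < d)%N -> 0 < S ->
  tanh_decay_constant d S aT ->
   exists M0 : R, forall (O : set 'rV[R]_d) (L1 L2 L3 L4 L5 r0 : R),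
    good_domain O ->
    0 < L1 -> 0 < L2 -> 0 < L3 -> 0 < L4 -> 0 < L5 -> 0 < r0 ->
    exists2 q : R, 0 < q &
      forall (P : coeffs R d) (alow : R) (n1 n2 N : nat)
             (x : 'I_(n1 + n2) -> 'rV[R]_d) (k : 'I_(N + N) -> 'rV[R]_d)
             (v : 'I_(N + N) -> R) (s : seq R) (M : R),
        bounded_coeffs O L1 L2 L3 L4 L5 P ->
        0 < alow -> elliptic O P alow ->
        (0 < n1)%N -> (0 < n2)%N -> (N + N < n1 + n2)%N ->
        collocation O x ->
        0 < M -> M0 <= M -> 3 * M * ln (15 * M) <= (N + N)%:R - 1 ->
        (forall j, in_cube S (k j)) ->
        (forall j, `|v j| <= d%:R * S) ->
        (forall y, O y -> cb P y = 0) ->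
        2 * r0 <= min_width (fun i : 'I_n1 => x (lshift n2 i)) ->
        singular_values (feature_mx O P (tanh_features k v) x) s ->
        ((q * (alow / Num.sqrt ((n1 + n2)%:R * N%:R))
            * expR (Num.min aT (d%:R * ln 2 / (4 * expR 1)) * M `^ d%:R^-1))%:E
         <= sing_ratio s (N + N))%E.
Proof.
move=> d0 S0 [aT0 [M0 M0P]].
set at' := Num.min aT _.
have atd : at' <= d%:R.
  rewrite /at' ge_min; apply/orP; right.
  have e1 : 1 <= expR (1 : R) by rewrite -expR0 ler_expR.
  rewrite ler_pdivrMr ?mulr_gt0 ?expR_gt0 // ler_wpM2l //.
  have l2 : ln 2 <= 1 :> R by apply: (@le_ln1Dx R 1); lra.
  lra.
have d1 : 1 <= d%:R :> R by rewrite ler1n.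
(* Chosen so that [(4 e)^D = exp (- d D)], which beats the stated rate since [at' <= d] and
   [D >= M^(1/d)]. *)
pose e : R := expR (- d%:R) / 4.
have e0 : 0 < e by rewrite divr_gt0 ?expR_gt0.
(* Besides the threshold of [aT]: the exponential serves [degree_count] with [c = 1], and [3 ^+ d]
   ensures [D >= 3]. *)
exists (Num.max M0 (expR ((2 * 1%:R) ^+ d) + 3 ^+ d)).
move=> O L1 L2 L3 L4 L5 r0 gO L1p L2p L3p L4p L5p r00.
set CL := d%:R ^+ 2 * L1 + d%:R * (L2 + L4) + (L3 + L5).
have CL0 : 0 < CL.
  by rewrite /CL ltr_wpDl ?addr_gt0 // addr_ge0 ?mulr_ge0 ?addr_ge0 ?exprn_ge0 // ltW.
have [C C0 CP] := M0P O L1 L2 L3 L4 L5 gO L1p L2p L3p L4p L5p.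
pose c0 := r0 / 2 * expR (2 * d%:R * S) ^- 3.
have c00 : 0 < c0 by rewrite mulr_gt0 ?divr_gt0 ?invr_gt0 ?exprn_gt0 ?expR_gt0.
pose w := 2 * d%:R / e.
have w0 : 0 < w by rewrite divr_gt0 // mulr_gt0 // ltr0n.
have den0 : 0 < C + 2 * CL by rewrite addr_gt0 // mulr_gt0.
(* The denominator [C + 2 CL] dominates the constants of both regimes, which meet at [w K = 1]. *)
set q := c0 / w ^+ 3 / (C + 2 * CL).
have q0 : 0 < q := divr_gt0 (divr_gt0 c00 (exprn_gt0 3 w0)) den0.
exists q => //.
move=> P alow n1 n2 N x k v s M bP a0 eP n10 n20 Nn xC Mp MM NM kS vS b0 wx sP.
have [M0M MM'] : M0 <= M /\ expR ((2 * 1%:R) ^+ d) + 3 ^+ d <= M.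
  by move: MM; rewrite ge_max => /andP.
have y3 : 3 <= M `^ d%:R^-1.
  apply: powR_inv_ge => //; apply: le_trans MM'.
  by rewrite lerDr expR_ge0.
have eM : expR ((2 * 1%:R) ^+ d) <= M.
  by apply: le_trans MM'; rewrite lerDl exprn_ge0.
have M1 : 1 <= M.
  by apply: le_trans eM; rewrite -expR0 ler_expR exprn_ge0 // mulr_ge0.
have [D /andP[yD Dy]] := exists_degree d0 M1.
have DM := degree_count d0 eM Dy; rewrite mul1n in DM.
have Dp := lt_natB1 DM NM.
have D3 : (3 <= D)%N by rewrite -(ler_nat R) (le_trans y3).
have NN0 : (0 < N + N)%N := leq_ltn_trans (leq0n _) Dp.
have N0 : (0 < N)%N by move: NN0; rewrite addnn double_gt0.
have [j0 j0P] := exists_max_norm k NN0.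
have := sing_first_tanh gO S0 r00 a0 eP n10 xC (kS j0) (vS j0) b0 wx sP.
set K := `|k j0| in j0P *; rewrite -/c0 => s1P.
have K0 : 0 <= K := normr_ge0 _.
set Q := Num.sqrt _; have Q0 : 0 < Q.
  by rewrite sqrtr_gt0 mulr_gt0 // ltr0n // addn_gt0 n10.
set y := M `^ _ in y3 yD Dy *; have y0 : 0 <= y by lra.
set E := expR (at' * y); have E0 : 0 < E := expR_gt0 _.
apply: sing_ratio_ge; first exact: (sing_ge0 sP).
have pre0 : 0 <= q * (alow / Q) * E.
  exact: (mulr_ge0 (mulr_ge0 (ltW q0) (divr_ge0 (ltW a0) (ltW Q0))) (ltW E0)).
have [Ke|/ltW eK] := leP (2 * d%:R * K) e.
  have s2P := sing_last_small_tanh d0 gO L1p L2p L3p L4p L5p bP xC D3 Dp K0 j0P e0 Ke sP.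
  apply: le_trans (ler_wpM2l pre0 s2P) _; rewrite -/CL -/Q.
  have e4 : (4 * e) ^+ D <= E^-1.
    rewrite /e mulrC divfK // -expRM_natl -expRN ler_expR mulrN lerN2 mulrC.
    by apply: ler_pM => //; rewrite le_min (ltW aT0) divr_ge0 ?mulr_ge0 ?ln_ge0 ?expR_ge0 // ler1n.
  rewrite (_ : 2 * d%:R * K / e = w * K); last by rewrite /w; ring.
  have wK0 : 0 <= w * K by rewrite mulr_ge0 // ltW.
  apply: (@le_trans _ _ (q * (alow / Q) * E * (2 * Q * (CL * ((w * K) ^+ 3 * E^-1))))).
    have Q2 : 0 <= 2 * Q by rewrite mulr_ge0 // ltW.
    apply/(ler_wpM2l pre0)/(ler_wpM2l Q2)/(ler_wpM2l (ltW CL0)).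
    exact: (ler_wpM2l (exprn_ge0 3 wK0)).
  apply: le_trans s1P.
  rewrite [leLHS](_ : _ = (c0 * alow * K ^+ 3) * (2 * CL / (C + 2 * CL))); last first.
    by rewrite /q; field; rewrite !gt_eqF.
  apply: ler_piMr; last by rewrite ler_pdivrMr // mul1r lerDr ltW.
  exact: (mulr_ge0 (mulr_ge0 (ltW c00) (ltW a0)) (exprn_ge0 3 K0)).
have s2P : sing s (N + N) <= C * Q * expR (- aT * y).
  (* Used at the last index [m = N + N], where its lower bound on [m] is the assumption relating [M]
     and [N]. *)
  apply: (CP P n1 n2 N x k v s M (N + N)%N) => //; lra.
apply: le_trans (ler_wpM2l pre0 s2P) _.
have EaT : E * expR (- aT * y) <= 1.
  rewrite -expRD -expR0 ler_expR -mulrDl.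
  have : at' <= aT by rewrite ge_min lexx.
  by move=> ?; rewrite mulr_le0_ge0 // subr_le0.
have wK : 1 <= w * K by rewrite /w mulrAC ler_pdivlMr // mul1r.
apply: le_trans s1P.
rewrite [leLHS](_ : _ = (c0 * alow / w ^+ 3 * (C / (C + 2 * CL))) * (E * expR (- aT * y)));
  last by rewrite /q; field; rewrite !gt_eqF.
have CC : C / (C + 2 * CL) <= 1 by rewrite ler_pdivrMr // mul1r lerDl mulr_ge0 // ltW.
have CC0 : 0 <= C / (C + 2 * CL) by rewrite divr_ge0 ?ltW.
have cw0 : 0 <= c0 * alow / w ^+ 3.
  exact: (divr_ge0 (mulr_ge0 (ltW c00) (ltW a0)) (exprn_ge0 3 (ltW w0))).
apply: (@le_trans _ _ (c0 * alow / w ^+ 3)).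
  rewrite -[leRHS]mulr1; apply: ler_pM EaT.
  - exact: (mulr_ge0 cw0 CC0).
  - exact: (mulr_ge0 (ltW E0) (expR_ge0 _)).
  - exact: (ler_piMr cw0 CC).
rewrite ler_pdivrMr ?exprn_gt0 //.
have -> : c0 * alow * K ^+ 3 * w ^+ 3 = c0 * alow * (w * K) ^+ 3 by ring.
by apply: ler_peMr; [exact: (mulr_ge0 (ltW c00) (ltW a0)) | rewrite exprn_ege1].
Qed.

Theorem theorem5p2 (R : realType) (d : nat) (S : R) (hd : (0 < d)%N) (hS : 0 < S) :
  (* (1) Fourier features *)
  (exists M0 : R, forall (O : set 'rV[R]_d) (L1 L2 L3 L4 L5 : R),
    good_domain O ->
    0 < L1 -> 0 < L2 -> 0 < L3 -> 0 < L4 -> 0 < L5 ->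
    exists2 q : R, 0 < q &
      forall (P : coeffs R d) (alow : R) (n1 n2 N : nat)
             (x : 'I_(n1 + n2) -> 'rV[R]_d) (k : 'I_N -> 'rV[R]_d)
             (s : seq R) (M : R),
        bounded_coeffs O L1 L2 L3 L4 L5 P ->
        0 < alow -> elliptic O P alow ->
        (0 < n1)%N -> (0 < n2)%N -> (N + N < n1 + n2)%N ->
        collocation O x ->
        0 < M -> M0 <= M -> 3 * M * ln (15 * M) <= (N + N)%:R - 1 ->
        (forall j, in_cube S (k j)) ->
        singular_values (feature_mx O P (fourier_features k) x) s ->
        let C := Num.sqrt (n1%:R^-1 * \sum_(i < n1) cc P (x (lshift n2 i)) ^+ 2) in
        let G := Num.sqrt (n2%:R^-1 * \sum_(i < n2) cg2 P (x (rshift n1 i)) ^+ 2) in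
        ((q * ((Num.sqrt n1%:R * (alow + C) + Num.sqrt n2%:R * G)
                 / Num.sqrt ((n1 + n2)%:R * N%:R))
            * expR (aF R d * M `^ d%:R^-1 * ln M))%:E
         <= sing_ratio s (N + N))%E)
  /\
  (* (2) tanh features *)
  (forall aT : R, tanh_decay_constant d S aT ->
   exists M0 : R, forall (O : set 'rV[R]_d) (L1 L2 L3 L4 L5 r0 : R),
    good_domain O ->
    0 < L1 -> 0 < L2 -> 0 < L3 -> 0 < L4 -> 0 < L5 -> 0 < r0 ->
    exists2 q : R, 0 < q &
      forall (P : coeffs R d) (alow : R) (n1 n2 N : nat)
             (x : 'I_(n1 + n2) -> 'rV[R]_d) (k : 'I_(N + N) -> 'rV[R]_d)
             (v : 'I_(N + N) -> R) (s : seq R) (M : R),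
        bounded_coeffs O L1 L2 L3 L4 L5 P ->
        0 < alow -> elliptic O P alow ->
        (0 < n1)%N -> (0 < n2)%N -> (N + N < n1 + n2)%N ->
        collocation O x ->
        0 < M -> M0 <= M -> 3 * M * ln (15 * M) <= (N + N)%:R - 1 ->
        (forall j, in_cube S (k j)) ->
        (forall j, `|v j| <= d%:R * S) ->
        (forall y, O y -> cb P y = 0) ->
        2 * r0 <= min_width (fun i : 'I_n1 => x (lshift n2 i)) ->
        singular_values (feature_mx O P (tanh_features k v) x) s ->
        ((q * (alow / Num.sqrt ((n1 + n2)%:R * N%:R))
            * expR (Num.min aT (d%:R * ln 2 / (4 * expR 1)) * M `^ d%:R^-1))%:E
         <= sing_ratio s (N + N))%E).
Proof.
split; first exact: sing_ratio_fourier.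
by move=> aT aTP; exact: sing_ratio_tanh.
Qed.
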